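(* Let $\rho$ be a density on the unit ball $\mathbb{B}^n\subset\mathbb{R}^n$ satisfying the following two conditions. (i) There is a constant $1\le c_0<\infty$ such that for every $x\in\mathbb{B}^n$ and every $y$ in the Euclidean ball of centre $x$ and radius $d(x)/2$, $c_0^{-1}\le\rho(y)/\rho(x)\le c_0$. (ii) There is a constant $1\le c<\infty$ such that for all $x,y\in\partial_\rho\mathbb{B}^n$, \[ c^{-1}d_\rho(x,y)\le\int_0^{d(x,y)}\rho((1-t)x)\,dt+\int_0^{d(x,y)}\rho((1-t)y)\,dt\le c\,d_\rho(x,y). \] Let $\beta>-1$ and let \[ A\subset\{x\in\partial_\rho\mathbb{B}^n: k^+(x)\le\beta\},\quad B\subset\{x\in\partial_\rho\mathbb{B}^n: k^-(x)\ge\beta\},\quad C\subset\{x\in\partial_\rho\mathbb{B}^n: k^-(x)\le\beta\}. \] Then: (1) $(1+\beta)\dim_\rho(A)\ge\dim_d(A)$; (2) $(1+\beta)\dim_\rho(B)\le\dim_d(B)$; (3) $(1+\beta)\operatorname{Dim}_\rho(A)\ge\operatorname{Dim}_d(A)$; (4) $(1+\beta)\operatorname{Dim}_\rho(B)\le\operatorname{Dim}_d(B)$; (5) $(1+\beta)\operatorname{Dim}_\rho(C)\ge\dim_d(C)$.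
   Context: Setting: $\Omega=\mathbb{B}^n=\{x\in\mathbb{R}^n:|x|<1\}$, $S^{n-1}=\{|x|=1\}$. The internal metric $d$ on $\mathbb{B}^n$ (infimum of Euclidean lengths of curves in $\mathbb{B}^n$) is the Euclidean metric, its completion $\overline\Omega_d$ is the closed ball, and the internal boundary is $\partial\Omega_d=S^{n-1}$. $d(x)=1-|x|$ is the distance from $x$ to the boundary. $\rho$-metric. For a continuous $\rho\colon\Omega\to(0,\infty)$ and a rectifiable curve $\gamma$, $\ell_\rho(\gamma)=\int_\gamma\rho(z)|dz|$ (integration with respect to arclength), and $d_\rho(x,y)=\inf_\gamma\ell_\rho(\gamma)$, the infimum over all rectifiable curves joining $x$ to $y$ in $\Omega$. $\overline\Omega_\rho$ is the metric completion of $(\Omega,d_\rho)$ and $\partial_\rho\Omega=\overline\Omega_\rho\setminus\Omega$. Density. A density on $\Omega$ is a continuous function $\rho\colon\Omega\to(0,\infty)$ with $\partial_\rho\Omega\ne\emptyset$ such that for all sequences $(x_i)$ in $\Omega$: (A1) if $(x_i)$ converges in $\overline\Omega_\rho$, then it converges in $\overline\Omega_d$; (A2) if $(x_i)$ converges in $\overline\Omega_d$, then it has at most one accumulation point in $\partial_\rho\Omega$. Equivalently, the identity map $(\Omega,d_\rho)\to(\Omega,d)$ extends to a continuous injective map $\overline\Omega_\rho\to\overline\Omega_d$; via this map $\partial_\rho\mathbb{B}^n$ is identified with a subset of $S^{n-1}$. Dimensions. For a separable metric space $(X,d_X)$ and $A\subset X$, $\dim_X(A)$ is the usual Hausdorff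 dimension. The packing dimension $\operatorname{Dim}_X(A)=\inf\{s\ge0:\mathcal P^s_X(A)=0\}$ is defined from $P^{s,\varepsilon}_X(A)=\sup\{\sum_i r_i^s\}$, the supremum over disjoint families of balls $B_X(x_i,r_i)$ with $x_i\in A$, $r_i\le\varepsilon$; $P^s_X(A)=\lim_{\varepsilon\downarrow0}P^{s,\varepsilon}_X(A)$; $\mathcal P^s_X(A)=\inf\{\sum_i P^s_X(A_i): A\subset\bigcup_i A_i\}$ (countable covers). Conventions: $\sup\emptyset=0$, $\inf\emptyset=\infty$. $\dim_d,\operatorname{Dim}_d$ denote these dimensions with respect to $d$, and $\dim_\rho,\operatorname{Dim}_\rho$ with respect to $d_\rho$. Radial limits. For $x\in S^{n-1}$, \[ k^-(x)=\liminf_{r\uparrow1}\frac{\log\rho(rx)}{\log(1-r)},\qquad k^+(x)=\limsup_{r\uparrow1}\frac{\log\rho(rx)}{\log(1-r)}. \] *)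

(* Defs.v *)
From HB Require Import structures.
From mathcomp Require Import all_boot all_order all_algebra.
From mathcomp Require Import all_classical all_reals all_analysis.

Set Implicit Arguments.
Unset Strict Implicit.
Unset Printing Implicit Defensive.

Import Order.TTheory GRing.Theory Num.Theory.
Import numFieldNormedType.Exports.

Local Open Scope classical_set_scope.
Local Open Scope ring_scope.
Local Open Scope ereal_scope.

(* A metric space is given by a carrier [X : set T] and a distance [d] on it.
   Distances take values in the extended reals because [d_rho] below is an
   infimum; on the spaces considered here they are always finite. *)
Section MetricSpace.
Context {R : realType} {T : Type}.
Variables (X : set T) (d : T -> T -> \bar R).

Definition mball (x : T) (r : R) : set T := [set y | X y /\ d x y < r%:E].

Definition mcvg (u : nat -> T) (x : T) : Prop := d (u i) x @[i --> \oo] --> 0.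

Definition cauchy_seq (u : nat -> T) : Prop :=
  forall e : R, (0 < e)%R ->
    exists N : nat, forall i j : nat,
      (N <= i)%N -> (N <= j)%N -> d (u i) (u j) < e%:E.

Definition accumulation_point (u : nat -> T) (x : T) : Prop :=
  forall (e : R) (N : nat), (0 < e)%R ->
    exists2 i : nat, (N <= i)%N & d (u i) x < e%:E.

(* The adjoined 0 implements the convention that the supremum of the empty
   set is 0. *)
Definition mdiam (U : set T) : \bar R :=
  ereal_sup (0 |` [set d x y | x in U & y in U]).

Definition hausdorff_content (s e : R) (A : set T) : \bar R :=
  ereal_inf [set h | exists (D : set nat) (U : nat -> set T),
    [/\ A `<=` \bigcup_(i in D) U i,
        forall i, D i -> U i `<=` X /\ mdiam (U i) <= e%:E
      & h = \esum_(i in D) (mdiam (U i) `^ s)]].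

Definition hausdorff_measure (s : R) (A : set T) : \bar R :=
  lim (hausdorff_content s e A @[e --> 0^'+]).

Definition hausdorff_dim (A : set T) : \bar R :=
  ereal_inf [set s%:E | s in
    [set s : R | (0 <= s)%R /\ hausdorff_measure s A = 0]].

(* Disjoint families of balls of a separable space are countable; they are
   indexed here by a subset [D] of [nat]. *)
Definition packing_content (s e : R) (A : set T) : \bar R :=
  ereal_sup [set h | exists (D : set nat) (x : nat -> T) (r : nat -> R),
    [/\ forall i, D i -> A (x i) /\ (0 < r i <= e)%R,
        trivIset D (fun i => mball (x i) (r i))
      & h = \esum_(i in D) ((r i) `^ s)%:E]].

Definition packing_premeasure (s : R) (A : set T) : \bar R :=
  lim (packing_content s e A @[e --> 0^'+]).

Definition packing_measure (s : R) (A : set T) : \bar R :=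
  ereal_inf [set h | exists2 V : nat -> set T,
    A `<=` \bigcup_i V i /\ (forall i, V i `<=` X)
    & h = \sum_(i <oo) packing_premeasure s (V i)].

Definition packing_dim (A : set T) : \bar R :=
  ereal_inf [set s%:E | s in
    [set s : R | (0 <= s)%R /\ packing_measure s A = 0]].

End MetricSpace.

(* The completion of [(X, d)]: its points are the equivalence classes of
   Cauchy sequences of [X], where [u] and [v] are equivalent when
   [d (u i) (v i)] tends to 0. *)
Definition completion_point (T : Type) : Type := set (nat -> T).

Section Completion.
Context {R : realType} {T : pointedType}.
Variables (X : set T) (d : T -> T -> \bar R).

Definition cauchy_in (u : nat -> T) : Prop :=
  (forall i, X (u i)) /\ cauchy_seq d u.

Definition cauchy_class (u : nat -> T) : completion_point T :=
  [set v | cauchy_in v /\ d (u i) (v i) @[i --> \oo] --> 0].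

Definition completion : set (completion_point T) :=
  [set p | exists2 u, cauchy_in u & p = cauchy_class u].

(* [get p] picks a representative of the class [p]; the limit does not depend
   on it. *)
Definition completion_dist (p q : completion_point T) : \bar R :=
  lim (d ((get p : nat -> T) i) ((get q : nat -> T) i) @[i --> \oo]).

Definition completion_embed (x : T) : completion_point T :=
  cauchy_class (fun=> x).

End Completion.

Section Ball.
Context {R : realType} {n : nat}.
Implicit Types (x y : 'rV[R]_n).

(* The library norm on row vectors is the sup norm; it induces the same
   topology as this one. *)
Definition enorm x : R := Num.sqrt (\sum_(i < n) x ord0 i ^+ 2)%R.

Definition euclid_dist x y : \bar R := (enorm (x - y))%:E.

Definition unit_ball : set 'rV[R]_n := [set x | (enorm x < 1)%R].
Definition closed_unit_ball : set 'rV[R]_n := [set x | (enorm x <= 1)%R].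

Definition bdist x : R := (1 - enorm x)%R.

(* Length of the curve [g] between the parameters [a <= b]. *)
Definition curve_length (g : R -> 'rV[R]_n) (a b : R) : \bar R :=
  ereal_sup [set (\sum_(0 <= k < size s)
      enorm (g (nth b (a :: s) k.+1) - g (nth b (a :: s) k)))%R%:E
    | s in itv_partition a b].

(* Rectifiable curves, parametrized by [0, 1], joining [x] to [y] in the
   ball. *)
Definition rectifiable_curve x y (g : R -> 'rV[R]_n) : Prop :=
  [/\ {within `[0%R, 1%R], continuous g},
      forall t, (0 <= t <= 1)%R -> unit_ball (g t),
      g 0%R = x, g 1%R = y
    & curve_length g 0 1 < +oo].

(* The parametrization of [g] by arclength: its value at [s] is [g t] for any
   [t] such that the restriction of [g] to [0, t] has length [s]. *)
Definition arclength_param (g : R -> 'rV[R]_n) (s : R) : 'rV[R]_n :=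
  g (get [set t | (0 <= t <= 1)%R /\ curve_length g 0 t = s%:E]).

Variable rho : 'rV[R]_n -> R.

Definition rho_length (g : R -> 'rV[R]_n) : \bar R :=
  \int[lebesgue_measure]_(s in `[0%R, fine (curve_length g 0 1)])
    (rho (arclength_param g s))%:E.

Definition rho_dist x y : \bar R :=
  ereal_inf [set rho_length g | g in rectifiable_curve x y].

Definition rho_completion : set (completion_point 'rV[R]_n) :=
  completion unit_ball rho_dist.

Definition rho_cdist : completion_point 'rV[R]_n ->
    completion_point 'rV[R]_n -> \bar R :=
  completion_dist rho_dist.

Definition rho_embed : 'rV[R]_n -> completion_point 'rV[R]_n :=
  completion_embed unit_ball rho_dist.

Definition rho_boundary : set (completion_point 'rV[R]_n) :=
  rho_completion `\` rho_embed @` unit_ball.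

(* The completion of the ball for its internal metric is the closed unit ball
   with the Euclidean metric. *)
Record is_density : Prop := IsDensity {
  density_continuous : {within unit_ball, continuous rho};
  density_gt0 : forall x, unit_ball x -> (0 < rho x)%R;
  density_boundary : rho_boundary !=set0;
  density_A1 : forall u : nat -> 'rV[R]_n, (forall i, unit_ball (u i)) ->
    (exists2 p, rho_completion p & mcvg rho_cdist (rho_embed \o u) p) ->
    exists2 x, closed_unit_ball x & mcvg euclid_dist u x;
  density_A2 : forall u : nat -> 'rV[R]_n, (forall i, unit_ball (u i)) ->
    (exists2 x, closed_unit_ball x & mcvg euclid_dist u x) ->
    forall p q, rho_boundary p -> rho_boundary q ->
      accumulation_point rho_cdist (rho_embed \o u) p ->
      accumulation_point rho_cdist (rho_embed \o u) q -> p = q }.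

(* The continuous extension, to the rho-completion, of the identity map of the
   ball. For a density it is injective and maps the rho-boundary into the unit
   sphere. *)
Definition boundary_map (p : completion_point 'rV[R]_n) : 'rV[R]_n :=
  get [set x | closed_unit_ball x /\
    forall u : nat -> 'rV[R]_n, (forall i, unit_ball (u i)) ->
      mcvg rho_cdist (rho_embed \o u) p -> mcvg euclid_dist u x].

Definition radial_exponent x (r : R) : \bar R :=
  (ln (rho (r *: x)) / ln (1 - r))%R%:E.

Definition k_minus x : \bar R := limf_einf (radial_exponent x) 1^'-.
Definition k_plus x : \bar R := limf_esup (radial_exponent x) 1^'-.

(* The integral of [rho] along the radius ending at the point [x] of the
   sphere, up to depth [l]; for [l > 1] it goes on beyond the centre. The
   interval is open because [rho] is only meaningful inside the ball. *)
Definition radial_integral x (l : R) : \bar R :=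
  \int[lebesgue_measure]_(t in `]0%R, l[) (rho ((1 - t) *: x))%:E.

Definition dim_d (A : set 'rV[R]_n) : \bar R :=
  hausdorff_dim closed_unit_ball euclid_dist A.
Definition Dim_d (A : set 'rV[R]_n) : \bar R :=
  packing_dim closed_unit_ball euclid_dist A.
Definition dim_rho (A : set (completion_point 'rV[R]_n)) : \bar R :=
  hausdorff_dim rho_completion rho_cdist A.
Definition Dim_rho (A : set (completion_point 'rV[R]_n)) : \bar R :=
  packing_dim rho_completion rho_cdist A.

End Ball.

(* Main.v *)
Require Import Defs.
From mathcomp Require Import all_boot all_order all_algebra.
From mathcomp Require Import all_classical all_reals all_analysis.
From mathcomp Require Import measurable_realfun ring lra.

(** Write [F p l] for the integral of [rho] over the last part of length [l] of
    the radius ending at the boundary point [p]. By (ii), [d_rho p q] is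
    comparable to [F p l + F q l], where [l] is the Euclidean distance of [p]
    and [q].

    If [rho ((1 - t) x) <= t^(a-1)] for all small [t], then [F p l <= l^a / a],
    so Euclidean distance controls [d_rho] with exponent [a]. If
    [rho ((1 - t) x) >= t^(a-1)] for one [t], then Harnack's inequality (i) on
    the radial segment between depths [t/2] and [t] yields
    [F p t >= const t^a]; when this holds for all small [t], [d_rho] controls
    Euclidean distance with exponent [1/a]. Up to countable unions, [A] and [B]
    satisfy such uniform bounds for every [a > 1 + beta], respectively
    [a < 1 + beta], and null sets for Hausdorff or packing measures are
    transported with the exponent multiplied or divided by [a]. On [C] the lower
    bound is available only along a sequence of scales depending on the point;
    a Vitali selection among the balls at these scales turns a cover of [f(C)]
    into a [d_rho]-packing centred on [C].

    Carrying balls of radius [t] to disjoint [d_rho]-balls uses the triangle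
    inequality of [d_rho] in the completion, hence that rectifiable curves can be
    reversed and concatenated: this is done on arclength parametrizations. *)

Import Order.TTheory GRing.Theory Num.Theory.
Import numFieldNormedType.Exports.

Set Implicit Arguments.
Unset Strict Implicit.
Unset Printing Implicit Defensive.

Local Open Scope classical_set_scope.
Local Open Scope ring_scope.

(** * The Euclidean norm *)

Section EuclideanNorm.
Context {R : realType} {n : nat}.
Implicit Types x y z : 'rV[R]_n.

Lemma enorm_ge0 x : 0 <= enorm x.
Proof. exact: sqrtr_ge0. Qed.

Lemma enorm_sqr x : enorm x ^+ 2 = \sum_(i < n) x ord0 i ^+ 2.
Proof. by rewrite sqr_sqrtr// sumr_ge0// => i _; rewrite sqr_ge0. Qed.

Lemma enorm0 : enorm (0 : 'rV[R]_n) = 0.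
Proof.
by rewrite /enorm big1 ?sqrtr0// => i _; rewrite mxE expr0n.
Qed.

Lemma enormZ (a : R) x : enorm (a *: x) = `|a| * enorm x.
Proof.
rewrite /enorm -sqrtr_sqr -sqrtrM ?sqr_ge0// mulr_sumr.
by congr Num.sqrt; apply: eq_bigr => i _; rewrite mxE exprMn.
Qed.

Lemma enormN x : enorm (- x) = enorm x.
Proof. by rewrite -scaleN1r enormZ normrN1 mul1r. Qed.

Lemma enorm_distC x y : enorm (x - y) = enorm (y - x).
Proof. by rewrite -enormN opprB. Qed.

Lemma enorm_eq0_coord x i : enorm x = 0 -> x ord0 i = 0.
Proof.
move=> x0; have := enorm_sqr x; rewrite x0 expr0n/= => /esym/eqP.
rewrite psumr_eq0 => [/allP/(_ i)|j _]; last exact: sqr_ge0.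
by rewrite mem_index_enum sqrf_eq0 => /(_ isT)/eqP.
Qed.

(** Sum the inequalities [(|y| x_i - |x| y_i)^2 >= 0] and divide by [2 |x| |y|]; the cases where a
    norm vanishes are settled first. *)
Lemma enorm_cauchy_schwarz x y :
  \sum_(i < n) x ord0 i * y ord0 i <= enorm x * enorm y.
Proof.
have [x0|x0] := eqVneq (enorm x) 0.
  by rewrite x0 mul0r big1// => i _; rewrite (enorm_eq0_coord i x0) mul0r.
have [y0|y0] := eqVneq (enorm y) 0.
  by rewrite y0 mulr0 big1// => i _; rewrite (enorm_eq0_coord i y0) mulr0.
have xp : 0 < enorm x by rewrite lt0r x0 enorm_ge0.
have yp : 0 < enorm y by rewrite lt0r y0 enorm_ge0.
have h i : 2 * (enorm x * enorm y) * (x ord0 i * y ord0 i) <=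
    enorm y ^+ 2 * x ord0 i ^+ 2 + enorm x ^+ 2 * y ord0 i ^+ 2.
  rewrite -subr_ge0.
  by have := sqr_ge0 (enorm y * x ord0 i - enorm x * y ord0 i); lra.
have : \sum_(i < n) 2 * (enorm x * enorm y) * (x ord0 i * y ord0 i) <=
    \sum_(i < n) (enorm y ^+ 2 * x ord0 i ^+ 2 + enorm x ^+ 2 * y ord0 i ^+ 2).
  by apply: ler_sum => i _; exact: h.
rewrite big_split/= -!mulr_sumr -!enorm_sqr => H.
rewrite -(ler_pM2l (_ : 0 < 2 * (enorm x * enorm y))) ?mulr_gt0//.
apply: le_trans H _; lra.
Qed.

Lemma enormD x y : enorm (x + y) <= enorm x + enorm y.
Proof.
rewrite -(ler_pXn2r (n := 2))// ?nnegrE ?addr_ge0 ?enorm_ge0//.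
rewrite sqrrD !enorm_sqr.
have -> : \sum_(i < n) (x + y) ord0 i ^+ 2 = \sum_(i < n) x ord0 i ^+ 2 +
   2 * (\sum_(i < n) x ord0 i * y ord0 i) + \sum_(i < n) y ord0 i ^+ 2.
  rewrite mulr_sumr -!big_split/=; apply: eq_bigr => i _.
  by rewrite mxE; ring.
by have := enorm_cauchy_schwarz x y; lra.
Qed.

Lemma enorm_triangle z x y : enorm (x - y) <= enorm (x - z) + enorm (z - y).
Proof. by rewrite (le_trans _ (enormD _ _))// addrA subrK. Qed.

Lemma norm_le_enorm x : `|x| <= enorm x.
Proof.
rewrite [leLHS]mx_normrE; apply: bigmax_le => [|[i j] _ /=].
  exact: enorm_ge0.
rewrite ord1 -sqrtr_sqr ler_wsqrtr// (bigD1 j)//= lerDl.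
by rewrite sumr_ge0// => k _; rewrite sqr_ge0.
Qed.

Lemma enorm_le_norm x : enorm x <= n%:R * `|x|.
Proof.
rewrite -(ler_pXn2r (n := 2))// ?nnegrE ?mulr_ge0 ?enorm_ge0//.
rewrite enorm_sqr exprMn.
apply: (@le_trans _ _ (\sum_(i < n) `|x| ^+ 2)).
  apply: ler_sum => i _; rewrite -[x ord0 i ^+ 2]real_normK ?num_real//.
  rewrite ler_pXn2r ?nnegrE// [leRHS]mx_normrE.
  by apply/bigmax_geP; right; exists (ord0, i).
rewrite sumr_const card_ord -[leLHS]mulr_natl ler_wpM2r ?sqr_ge0//.
by rewrite -natrX ler_nat; case: (n) => // k; rewrite expnS leq_pmulr// expn1.
Qed.

Lemma enorm_continuous : continuous (@enorm R n).
Proof.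
move=> x; have Fx : Filter (nbhs x) by exact: nbhs_filter.
apply/cvgrPdist_le => e e0.
(* The factor [n + 1] replaces [n] so that dividing by it is legitimate even in dimension 0. *)
have n0 : (0 : R) < n%:R + 1 by rewrite ltr_wpDl.
near=> y.
apply: (@le_trans _ _ (enorm (x - y))).
  rewrite ler_norml; apply/andP; split.
    by rewrite lerNl opprB lerBlDr enorm_distC (le_trans _ (enormD _ _))// subrK.
  by rewrite lerBlDr (le_trans _ (enormD _ _))// subrK.
apply: le_trans (enorm_le_norm _) _.
apply: (@le_trans _ _ ((n%:R + 1) * `|x - y|)).
  by rewrite ler_wpM2r// lerDl.
rewrite -ler_pdivlMl//.
near: y; apply: cvgr_dist_le; first exact: cvg_id.
by rewrite mulr_gt0// invr_gt0.
Unshelve. all: by end_near. Qed.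

Lemma open_unit_ball : open (@unit_ball R n).
Proof.
rewrite (_ : unit_ball = @enorm R n @^-1` [set r | r < 1]); last by [].
apply: open_comp; last exact: open_lt.
by move=> x _; exact: enorm_continuous.
Qed.

Lemma enorm_scale_lt1 (a : R) x : enorm x <= 1 -> `|a| < 1 -> unit_ball (a *: x).
Proof.
move=> x1 a1; rewrite /unit_ball/= enormZ.
by rewrite (le_lt_trans _ a1)// ler_piMr.
Qed.

End EuclideanNorm.

(** * Length of curves *)

Section PolygonalLength.
Context {R : realType} {n : nat}.
Implicit Types (g : R -> 'rV[R]_n) (a b c t : R) (s : seq R).

(** Recursion on the vertex list, with the starting point kept apart, replaces the indexed sum in
    [curve_length], so that cutting, concatenating and reversing polygons become list inductions. *)
Fixpoint poly_length g a s : R :=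
  if s is b :: s' then enorm (g b - g a) + poly_length g b s' else 0.

Lemma poly_length_cat g a s1 s2 :
  poly_length g a (s1 ++ s2) = poly_length g a s1 + poly_length g (last a s1) s2.
Proof. by elim: s1 a => [|b s1 ih] a /=; rewrite ?add0r// ih addrA. Qed.

Lemma poly_length_rev g a s :
  poly_length g (last a s) (rev (belast a s)) = poly_length g a s.
Proof.
elim: s a => //= b s ih a; rewrite rev_cons -cats1 poly_length_cat/= ih.
rewrite addr0 addrC enorm_distC; congr (enorm (_ - g _) + _).
by case: s {ih} => //= c s; rewrite rev_cons last_rcons.
Qed.

Lemma poly_length_map g (h : R -> R) a s :
  poly_length g (h a) (map h s) = poly_length (g \o h) a s.
Proof. by elim: s a => //= b s ih a; rewrite ih. Qed.

Lemma eq_poly_length g g' a s : (forall t, t \in a :: s -> g t = g' t) ->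
  poly_length g a s = poly_length g' a s.
Proof.
elim: s a => //= b s ih a gg'; rewrite !gg' ?inE ?eqxx ?orbT// ih// => t ts.
by rewrite gg'// inE ts orbT.
Qed.

Lemma path_le_bounds a s t : path <=%R a s -> t \in a :: s -> a <= t <= last a s.
Proof.
elim: s a t => [|b s ih] a t /=; first by rewrite inE => _ /eqP ->; rewrite lexx.
move=> /andP[ab bs]; rewrite inE => /predU1P[->|/(ih _ _ bs)/andP[bt tl]].
  rewrite lexx (le_trans ab)//.
  by have /andP[] := ih _ b bs (mem_head _ _).
by rewrite tl (le_trans ab).
Qed.

Lemma poly_length_lipschitz g (k : R) a s : path <=%R a s ->
  (forall u v, a <= u -> u <= v -> v <= last a s ->
    enorm (g v - g u) <= k * (v - u)) ->
  poly_length g a s <= k * (last a s - a).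
Proof.
elim: s a => [|b s ih] a /=; first by rewrite subrr mulr0.
move=> /andP[ab bs] gk.
have bl : b <= last b s by have /andP[] := path_le_bounds bs (mem_head _ _).
apply: (le_trans (lerD (gk _ _ (lexx _) ab bl) (ih _ bs _))); last lra.
by move=> u v bu uv vl; apply: gk => //; exact: le_trans bu.
Qed.

Lemma curve_lengthE g a b : curve_length g a b =
  ereal_sup [set (poly_length g a s)%:E | s in itv_partition a b].
Proof.
congr ereal_sup; apply: eq_imagel => s _ /=.
suff -> : forall s a, (\sum_(0 <= k < size s)
  enorm (g (nth b (a :: s) k.+1) - g (nth b (a :: s) k)) = poly_length g a s)%R.
  by [].
elim=> [|c {}s ih] {}a /=; first by rewrite big_geq.
by rewrite big_nat_recl//= ih.
Qed.

(** Partitions in [curve_length] are strictly increasing. Repeated vertices contribute zero edges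
    and can be deleted, so weakly increasing lists are admissible too. *)
Lemma poly_length_le_curve_length g a b s : path <=%R a s -> last a s = b ->
  ((poly_length g a s)%:E <= curve_length g a b)%E.
Proof.
move=> as_ sb; rewrite curve_lengthE.
have [s' [as' ls' ->]] : exists s', [/\ path <%R a s', last a s' = last a s &
    poly_length g a s = poly_length g a s'].
  elim: s a as_ {sb} => [|c s ih] a /=; first by exists [::].
  move=> /andP[ac /ih[s' [cs' ls' e]]].
  have [ac'|ac'] := eqVneq a c.
    by exists s'; rewrite e ac' subrr enorm0 add0r; split.
  by exists (c :: s'); rewrite /= lt_neqAle ac' ac cs' ls' e; split.
by apply: ereal_sup_ubound; exists s' => //; split=> //; rewrite ls' sb.
Qed.

Lemma curve_length_le g a b (k : \bar R) :
  (forall s, path <=%R a s -> last a s = b -> ((poly_length g a s)%:E <= k)%E) ->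
  (curve_length g a b <= k)%E.
Proof.
move=> h; rewrite curve_lengthE; apply: ge_ereal_sup => _ [s [as_ /eqP sb] <-].
by apply: h => //; apply: sub_path as_ => x y /ltW.
Qed.

Lemma chord_le_curve_length g a b : a <= b ->
  ((enorm (g b - g a))%:E <= curve_length g a b)%E.
Proof.
move=> ab; rewrite -[enorm _]addr0.
by apply: (@poly_length_le_curve_length g a b [:: b]) => //=; rewrite ab.
Qed.

Lemma curve_length_ge0 g a b : a <= b -> (0 <= curve_length g a b)%E.
Proof.
by move=> /(chord_le_curve_length g); apply: le_trans; rewrite lee_fin enorm_ge0.
Qed.

(** Partitions of the two intervals concatenate to a partition of the whole. The suprema are taken
    one after the other by subtraction, which is why the infinite case is removed first. *)
Lemma curve_length_superadditive g a b c : a <= b -> b <= c ->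
  (curve_length g a b + curve_length g b c <= curve_length g a c)%E.
Proof.
move=> ab bc.
have [->|] := eqVneq (curve_length g a c) +oo%E; first by rewrite leey.
rewrite -ltey => acoo.
have acfin : curve_length g a c \is a fin_num.
  by rewrite ge0_fin_numE// curve_length_ge0// (le_trans ab).
rewrite -leeBrDr; last first.
  rewrite ge0_fin_numE ?curve_length_ge0//.
  apply: le_lt_trans acoo; apply: curve_length_le => s bs sc.
  apply: le_trans (@poly_length_le_curve_length g a c (b :: s) _ _) => //=.
    by rewrite lee_fin lerDr enorm_ge0.
  by rewrite ab.
apply: curve_length_le => s as_ sb.
rewrite leeBrDl; last first.
  rewrite ge0_fin_numE ?curve_length_ge0//.
  apply: le_lt_trans acoo; apply: curve_length_le => s' bs sc.
  apply: le_trans (@poly_length_le_curve_length g a c (b :: s') _ _) => //=.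
    by rewrite lee_fin lerDr enorm_ge0.
  by rewrite ab.
rewrite -leeBrDr//; apply: curve_length_le => s' bs' s'c.
rewrite leeBrDl// -EFinD.
apply: le_trans (@poly_length_le_curve_length g a c (s ++ s') _ _).
- by rewrite lee_fin poly_length_cat sb.
- by rewrite cat_path as_ sb.
- by rewrite last_cat sb.
Qed.

(** No vertex lies strictly between [t] and [t'], so a single edge crosses this gap, and inserting
    [t] and [t'] into it can only lengthen the polygon. The case [t = t'] gives additivity of
    length; nearby [t] and [t'] give its continuity. *)
Lemma poly_length_cut g a s t t' : a <= t -> t <= t' -> t' <= last a s ->
  path <=%R a s -> (forall u, u \in s -> u <= t \/ t' <= u) ->
  ((poly_length g a s)%:E <= curve_length g a t + (enorm (g t' - g t))%:E +
    curve_length g t' (last a s))%E.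
Proof.
elim: s a => [|b s ih] a /=.
  move=> at_ tt' t'a _ _; rewrite !adde_ge0 ?curve_length_ge0//.
  by rewrite lee_fin enorm_ge0.
move=> at_ tt' t'l /andP[ab bs] cut.
have [bt|t'b] := cut b (mem_head _ _).
  have := ih b bt tt' t'l bs (fun u us => cut u (mem_behead (us : u \in behead (b :: s)))).
  move=> /(leeD2l (enorm (g b - g a))%:E); rewrite -EFinD => /le_trans; apply.
  rewrite !addeA leeD2r// leeD2r//.
  apply: le_trans (curve_length_superadditive g ab bt); rewrite leeD2r//.
  exact: chord_le_curve_length.
apply: (@le_trans _ _ ((enorm (g t - g a))%:E + (enorm (g t' - g t))%:E +
    (poly_length g t' (b :: s))%:E)%E); last first.
  rewrite leeD//; first by rewrite leeD2r// chord_le_curve_length.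
  by apply: poly_length_le_curve_length => //=; rewrite t'b.
rewrite -!EFinD lee_fin /= addrA lerD2r.
have := enorm_triangle (g t) (g b) (g a).
have := enorm_triangle (g t') (g b) (g t); lra.
Qed.

End PolygonalLength.

(** * Curves of constant speed *)

Section ConstantSpeed.
Context {R : realType} {n : nat}.
Implicit Types (g : R -> 'rV[R]_n).

(* The second clause says that [g] has length at least [k * b] on [0, b]. *)
Definition constant_speed g (k b : R) : Prop :=
  (forall s t, 0 <= s -> s <= t -> t <= b -> enorm (g t - g s) <= k * (t - s)) /\
  (forall e, 0 < e -> exists s,
    [/\ path <=%R 0 s, last 0 s = b & k * b - e <= poly_length g 0 s]).

(** The upper bound is the Lipschitz condition. For the lower bound, nearly all of the length
    [k * b] is attained and at most [k * (b - t)] of it lies on [t, b], so the rest lies on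
    [0, t]. *)
Lemma constant_speed_curve_length g k b t : constant_speed g k b ->
  0 <= t -> t <= b -> curve_length g 0 t = (k * t)%:E.
Proof.
move=> [glip gpoly] t0 tb; apply/eqP; rewrite eq_le; apply/andP; split.
  apply: curve_length_le => s s0 sE; rewrite lee_fin.
  apply: le_trans (poly_length_lipschitz s0 (k := k) _) _; last by rewrite sE subr0.
  by move=> u v u0 uv vt; apply: glip => //; rewrite (le_trans vt)// sE.
apply/lee_addgt0Pr => e /gpoly[s [s0 sE sk]].
have := @poly_length_cut _ _ g 0 s t t t0 (lexx _).
rewrite sE => /(_ tb s0 (fun u _ => orP (le_total u t))).
rewrite subrr enorm0 adde0.
have tbk : (curve_length g t b <= (k * (b - t))%:E)%E.
  apply: curve_length_le => s' s't s'b; rewrite lee_fin -s'b.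
  apply: poly_length_lipschitz => // u v tu uv vb; apply: glip => //.
    exact: le_trans tu.
  by rewrite -s'b.
move=> /le_trans /(_ (leeD2l _ tbk)); rewrite -leeBlDr//.
move=> /(leeD2r e%:E); apply: le_trans.
rewrite -EFinB -EFinD lee_fin; lra.
Qed.

End ConstantSpeed.

(** * Parametrization by arclength *)

Section ArclengthParam.
Context {R : realType} {n : nat}.
Variable g : R -> 'rV[R]_n.
Hypothesis g_cont : {within `[0%R, 1%R], continuous g}.
Hypothesis g_rect : (curve_length g 0 1 < +oo)%E.

Let V t : R := fine (curve_length g 0 t).

Lemma curve_length_fin t : 0 <= t -> t <= 1 -> curve_length g 0 t = (V t)%:E.
Proof.
move=> t0 t1; rewrite fineK// ge0_fin_numE ?curve_length_ge0//.
apply: le_lt_trans g_rect; apply: le_trans (curve_length_superadditive g t0 t1).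
by rewrite leeDl// curve_length_ge0.
Qed.

Lemma length_chord s t : 0 <= s -> s <= t -> t <= 1 ->
  V s + enorm (g t - g s) <= V t.
Proof.
move=> s0 st t1; rewrite -lee_fin EFinD -!curve_length_fin ?(le_trans st)//.
  by apply: le_trans (curve_length_superadditive g s0 st); rewrite leeD2l// chord_le_curve_length.
exact: le_trans st.
Qed.

Lemma length_le s t : 0 <= s -> s <= t -> t <= 1 -> V s <= V t.
Proof.
by move=> s0 st t1; rewrite (le_trans _ (length_chord s0 st t1))// lerDl enorm_ge0.
Qed.

Lemma length0 : V 0 = 0.
Proof.
apply/eqP; rewrite eq_le -!lee_fin -curve_length_fin// curve_length_ge0// andbT.
apply: curve_length_le => s s0 sE.
have := @poly_length_lipschitz _ _ g 0 0 s s0; rewrite mul0r lee_fin; apply.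
move=> u v u0 uv; rewrite sE => v0.
have -> : v = u by apply/eqP; rewrite eq_le uv (le_trans v0).
by rewrite subrr enorm0 mul0r.
Qed.

(** A finite list has a nearest point to [t0] other than [t0] itself, and [t] need only stay closer;
    [t0] may belong to the list, being an end point of the gap. *)
Lemma near_not_separated (s : seq R) (t0 : R) : \forall t \near t0,
  forall u, u \in s -> (u <= Num.min t t0) || (Num.max t t0 <= u).
Proof.
elim: s => [|u s ih]; first by near=> t.
have h : \forall t \near t0, (u <= Num.min t t0) || (Num.max t t0 <= u).
  have [ut|tu|->] := ltgtP u t0.
  - near=> t; rewrite le_min (ltW ut) andbT; apply/orP; left; apply/ltW.
    by near: t; exact: lt_nbhsr.
  - near=> t; rewrite ge_max (ltW tu) andbT; apply/orP; right; apply/ltW.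
    by near: t; exact: lt_nbhsl.
  - by near=> t; rewrite le_min ge_max lexx !andbT; case: (leP t0 t) => // /ltW ->.
near=> t => v; rewrite inE => /predU1P[->|].
  by near: t.
by move: v; near: t.
Unshelve. all: by end_near. Qed.

(** Fix a partition whose polygon has length at least [V 1 - e / 2]. If none of its vertices
    separates [t] from [t'], then [poly_length_cut] and superadditivity give
    [V t' - V t <= e / 2 + |g t' - g t|], and the chord is small by continuity of [g]. *)
Lemma length_continuous : {within `[0%R, 1%R], continuous V}.
Proof.
apply/subspace_continuousP => t0 t01.
apply/cvgrPdist_le => e e0.
have e2 : 0 < e / 2 by rewrite divr_gt0.
have n0 : (0 : R) < n%:R + 1 by rewrite ltr_wpDl.
have : ((V 1 - e / 2)%:E < curve_length g 0 1)%E.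
  by rewrite curve_length_fin// lte_fin ltrBlDr ltrDl.
rewrite curve_lengthE => /ereal_sup_gt[_ [s [s0 /eqP s1] <-]].
rewrite lte_fin => sV.
have {}s0 : path <=%R 0 s by apply: sub_path s0 => x y /ltW.
have step t t' : 0 <= t -> t <= t' -> t' <= 1 ->
    (forall u, u \in s -> (u <= t) || (t' <= u)) ->
    enorm (g t' - g t) <= e / 2 -> `|V t' - V t| <= e.
  move=> t0' tt' t1' cut ge.
  rewrite ger0_norm ?subr_ge0 ?length_le//.
  have := @poly_length_cut _ _ g 0 s t t' t0' tt'.
  rewrite s1 => /(_ t1' s0 (fun u us => orP (cut u us))).
  have := curve_length_superadditive g (le_trans t0' tt') t1'.
  rewrite !curve_length_fin ?(le_trans t0' tt')// ?(le_trans tt' t1')//.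
  case: (curve_length g t' 1) => [r| |]//; last first.
  rewrite -!EFinD !lee_fin; lra.
have /subspace_continuousP/(_ t0 t01) gt0 := g_cont.
have c0 : 0 < (n%:R + 1)^-1 * (e / 2) by rewrite mulr_gt0// invr_gt0.
have gnear : \forall t \near within [set` `[0, 1]] (nbhs t0),
    `|g t - g t0| <= (n%:R + 1)^-1 * (e / 2).
  move/cvgrPdistC_le : gt0; exact.
near=> t.
have t01' : [set` `[0, 1]] t by near: t; exact: withinT.
move: t01 t01'; rewrite /= !in_itv/= => /andP[t00 t01] /andP[t0' t1'].
have gt : enorm (g t - g t0) <= e / 2.
  apply: le_trans (enorm_le_norm _) _.
  apply: (@le_trans _ _ ((n%:R + 1) * `|g t - g t0|)).
    by rewrite ler_wpM2r// lerDl.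
  rewrite -ler_pdivlMl//; near: t.
  exact: gnear.
have cut : forall u, u \in s -> (u <= Num.min t t0) || (Num.max t t0 <= u).
  near: t; apply: cvg_within; exact: near_not_separated.
have [tt0|/ltW tt0] := leP t0 t.
  by rewrite distrC; apply: step => // u /cut; rewrite min_r// max_l.
apply: step => //; last by rewrite enorm_distC.
by move=> u /cut; rewrite min_l// max_r.
Unshelve. all: by end_near. Qed.

Lemma length_surj s : 0 <= s -> s <= V 1 -> exists t, [/\ 0 <= t, t <= 1 & V t = s].
Proof.
move=> s0 s1; have [] := IVT (ler01 : (0 : R) <= 1) length_continuous (v := s).
  by rewrite length0 min_l ?max_r ?s0 ?s1// (le_trans s0).
by move=> t; rewrite in_itv/= => /andP[t0 t1] <-; exists t.
Qed.

(** A chord is at most the difference of lengths. Hence the parameter picked by [get] in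
    [arclength_param] does not affect the point reached. *)
Lemma length_eq s t : 0 <= s -> s <= 1 -> 0 <= t -> t <= 1 -> V s = V t ->
  g s = g t.
Proof.
wlog st : s t / s <= t.
  move=> h s0 s1 t0 t1 E; case/orP: (le_total s t) => st; first exact: h.
  by apply/esym; apply: h.
move=> s0 s1 t0 t1 E; have := length_chord s0 st t1.
rewrite E gerDl => gle; apply/eqP; rewrite eq_sym -subr_eq0; apply/eqP/rowP => i.
by rewrite [RHS]mxE enorm_eq0_coord//; apply/eqP; rewrite eq_le gle enorm_ge0.
Qed.

Lemma arclength_paramE t : 0 <= t -> t <= 1 -> arclength_param g (V t) = g t.
Proof.
move=> t0 t1; rewrite /arclength_param; case: xgetP => [u _ [/andP[u0 u1] uV]|].
  by apply: length_eq => //; apply: EFin_inj; rewrite -curve_length_fin.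
by move=> /(_ t) /=; rewrite t0 t1 curve_length_fin// => /(_ (conj isT erefl)).
Qed.

(** Chords are bounded by differences of [V], and [V] carries a nearly optimal partition of [0, 1]
    to one of [0, V 1] with the same polygon. The image may have repeated points, whence the weak
    inequalities in [constant_speed]. *)
Lemma arclength_param_constant_speed : constant_speed (arclength_param g) 1 (V 1).
Proof.
split.
  move=> s t s0 st t1.
  have [t' [t0' t1' tE]] := length_surj (le_trans s0 st) t1.
  have [s' [s0' s1' sE]] := length_surj s0 (le_trans st t1).
  rewrite -{1}tE -{1}sE !arclength_paramE// mul1r.
  case/orP: (le_total s' t') => st'; first by have := length_chord s0' st' t1'; lra.
  have := length_chord t0' st' s1'; rewrite enorm_distC; lra.
move=> e e0; have : ((V 1 - e)%:E < curve_length g 0 1)%E.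
  by rewrite curve_length_fin// lte_fin ltrBlDr ltrDl.
rewrite curve_lengthE => /ereal_sup_gt[_ [s [s0 /eqP s1] <-]].
rewrite lte_fin => sV; exists (map V s).
have {}s0 : path <=%R 0 s by apply: sub_path s0 => x y /ltW.
have s01 t : t \in 0 :: s -> (0 <= t) && (t <= 1).
  by move=> /(path_le_bounds s0); rewrite s1.
split.
- rewrite -[X in path _ X]length0 path_map.
  apply: (@sub_in_path _ (mem (0 :: s)) <=%R) s0; last exact/allP.
  by move=> x y /s01/andP[x0 x1] /s01/andP[y0 y1] xy; exact: length_le.
- by rewrite -[X in last X]length0 last_map s1.
- rewrite mul1r -[X in poly_length _ X]length0 poly_length_map.
  rewrite (@eq_poly_length _ _ _ g) ?ltW// => t /s01/andP[t0 t1].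
  exact: arclength_paramE.
Qed.

End ArclengthParam.

(** * The distance [rho_dist] *)

Lemma integral_reflect {R : realType} (G : R -> R) (a b c : R) : a <= b ->
  continuous G ->
  (\int[lebesgue_measure]_(x in `[(c - b)%R, (c - a)%R]) (G x)%:E =
   \int[lebesgue_measure]_(x in `[a, b]) (G (c - x))%:E)%E.
Proof.
move=> ab cG; pose F x : R := c - x.
have DF : derive1 F = cst (-1).
  apply/funext => x; rewrite derive1E deriveB//.
  by rewrite derive_cst derive_id sub0r.
have cF : continuous F by move=> x; apply: cvgB; [exact: cvg_cst|exact: cvg_id].
rewrite (@integration_by_substitution_decreasing _ F)//.
- by apply: eq_integral => x _; rewrite !fctE DF opprK mulr1.
- by move=> x y _ _ xy; rewrite /F ltrD2l ltrN2.
- by rewrite DF => ? ?; exact: cvg_cst.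
- by rewrite DF; exact: is_cvg_cst.
- by rewrite DF; exact: is_cvg_cst.
- split => /=.
  + by move=> x _; exact: derivableB.
  + by apply: cvg_at_right_filter; exact: cF.
  + by apply: cvg_at_left_filter; exact: cF.
- exact: continuous_subspaceT.
Qed.

(** This lets the triangle inequality for [rho_dist] be checked on one pair of curves at a time. *)
Lemma lee_ereal_inf2 {R : realType} (P Q : set (\bar R)) (k : \bar R) :
  (forall u, P u -> 0 <= u)%E -> (forall v, Q v -> 0 <= v)%E ->
  (forall u v, P u -> Q v -> k <= u + v)%E ->
  (k <= ereal_inf P + ereal_inf Q)%E.
Proof.
move=> P0 Q0 h.
have iP0 : (0 <= ereal_inf P)%E by apply: le_ereal_inf_tmp => u /P0.
have iQ0 : (0 <= ereal_inf Q)%E by apply: le_ereal_inf_tmp => u /Q0.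
have [Poo|Pfin] := eqVneq (ereal_inf P) +oo%E.
  by rewrite Poo addye ?leey// gt_eqF// (lt_le_trans _ iQ0).
have [Qoo|Qfin] := eqVneq (ereal_inf Q) +oo%E.
  by rewrite Qoo addey ?leey// gt_eqF// (lt_le_trans _ iP0).
have {}Pfin : ereal_inf P \is a fin_num by rewrite ge0_fin_numE// ltey.
have {}Qfin : ereal_inf Q \is a fin_num by rewrite ge0_fin_numE// ltey.
rewrite -leeBlDl//; apply: le_ereal_inf_tmp => v Qv.
have [->|voo] := eqVneq v +oo%E; first by rewrite leey.
have vfin : v \is a fin_num by rewrite ge0_fin_numE ?Q0// ltey.
rewrite leeBlDl// -leeBlDr//; apply: le_ereal_inf_tmp => u Pu.
by rewrite leeBlDr// h.
Qed.

Section RhoDistance.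
Context {R : realType} {n : nat}.
Variable rho : 'rV[R]_n -> R.
Hypothesis rho_cont : {within unit_ball, continuous rho}.
Hypothesis rho_gt0 : forall x, unit_ball x -> 0 < rho x.

(* Extends curves on [0, l] to the whole line, where continuity needs no
   subspace topology. *)
Definition clamp (l s : R) : R := Num.max 0 (Num.min s l).

Lemma clamp_id l s : 0 <= s -> s <= l -> clamp l s = s.
Proof. by move=> s0 sl; rewrite /clamp min_l// max_r. Qed.

Lemma clamp_ge0 l s : 0 <= clamp l s.
Proof. by rewrite /clamp le_max lexx. Qed.

Lemma clamp_le l s : 0 <= l -> clamp l s <= l.
Proof. by move=> l0; rewrite /clamp ge_max l0 ge_min lexx orbT. Qed.

Lemma clamp_lipschitz l s t : s <= t -> clamp l s <= clamp l t <= clamp l s + (t - s).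
Proof.
rewrite /clamp => st; rewrite !maxEle !minEle.
by repeat case: ifPn; rewrite -?ltNge => *; apply/andP; split; lra.
Qed.

Lemma constant_speed_clamp_continuous (g : R -> 'rV[R]_n) k l : 0 <= l ->
  constant_speed g k l -> continuous (g \o clamp l).
Proof.
move=> l0 [glip _].
have lip s t : enorm (g (clamp l s) - g (clamp l t)) <= `|k| * `|s - t|.
  wlog st : s t / s <= t.
    by move=> h; case/orP: (le_total s t) => /h//; rewrite enorm_distC distrC.
  have /andP[c1 c2] := clamp_lipschitz l st.
  rewrite enorm_distC (le_trans (glip _ _ (clamp_ge0 _ _) c1 (clamp_le _ l0)))//.
  rewrite (le_trans (ler_norm _))// normrM ler_wpM2l//.
  by rewrite (distrC s) !ger0_norm ?subr_ge0// lerBlDl.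
move=> t; apply/cvgrPdist_le => e e0.
have k0 : 0 < `|k| + 1 by rewrite ltr_wpDl.
near=> s; rewrite (le_trans (norm_le_enorm _))// (le_trans (lip _ _))//.
apply: (@le_trans _ _ ((`|k| + 1) * `|t - s|)); first by rewrite ler_wpM2r// lerDl.
rewrite -ler_pdivlMl//; near: s.
by apply: cvgr_dist_le; [exact: cvg_id|rewrite mulr_gt0// invr_gt0].
Unshelve. all: by end_near. Qed.

Lemma rho_continuous_at x : unit_ball x -> {for x, continuous rho}.
Proof.
have := rho_cont; rewrite continuous_open_subspace; last exact: open_unit_ball.
by move=> h xb; apply: h; rewrite inE.
Qed.

Lemma rho_clamp_continuous (g : R -> 'rV[R]_n) k l : 0 <= l ->
  constant_speed g k l -> (forall s, 0 <= s -> s <= l -> unit_ball (g s)) ->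
  continuous (rho \o (g \o clamp l)).
Proof.
move=> l0 gk gb s; apply: continuous_comp.
  exact: constant_speed_clamp_continuous gk _.
by apply: rho_continuous_at; apply: gb; rewrite ?clamp_ge0 ?clamp_le.
Qed.

Lemma rho_length_ge0 (g : R -> 'rV[R]_n) x y : rectifiable_curve x y g ->
  (0 <= rho_length rho g)%E.
Proof.
move=> [gc gb _ _ gr]; apply: integral_ge0 => s /=.
rewrite in_itv/= => /andP[s0 s1].
have [t [t0 t1 <-]] := length_surj gc gr s0 s1.
by rewrite arclength_paramE// lee_fin ltW//; apply/rho_gt0/gb; rewrite t0.
Qed.

Lemma rho_dist_ge0 x y : (0 <= rho_dist rho x y)%E.
Proof. by apply: le_ereal_inf_tmp => _ [g /rho_length_ge0 + <-]. Qed.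

(** Competitors for [rho_dist] live on [0, 1], so time is rescaled by [l]. The rescaled curve has
    length [l * t] on [0, t], hence its arclength parametrization is [g] again. *)
Lemma rho_dist_le_integral (g : R -> 'rV[R]_n) l : 0 <= l ->
  constant_speed g 1 l -> (forall s, 0 <= s -> s <= l -> unit_ball (g s)) ->
  (rho_dist rho (g 0%R) (g l) <=
    \int[lebesgue_measure]_(s in `[0%R, l]) (rho (g s))%:E)%E.
Proof.
move=> l0 gl gb; pose h t := g (l * t).
have lt_ t : 0 <= t -> t <= 1 -> 0 <= l * t /\ l * t <= l.
  by move=> t0 t1; rewrite mulr_ge0// ler_piMr.
have hl : constant_speed h l 1.
  have [glip gpoly] := gl; split.
    move=> s t s0 st t1; have [ls0 ls1] := lt_ s s0 (le_trans st t1).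
    have [lt0 lt1] := lt_ t (le_trans s0 st) t1.
    by rewrite (le_trans (glip _ _ ls0 _ lt1)) ?ler_wpM2l// mul1r mulrBr.
  move=> e e0; have [s [s0 sl se]] := gpoly e e0.
  (* For [l = 0] rescaling by the inverse is impossible, but the required length is 0 and any
     partition will do. *)
  have [lE|l_neq0] := eqVneq l 0.
    exists [:: 1]; rewrite /= ler01; split => //.
    by rewrite lE mul0r sub0r (le_trans (_ : - e <= 0)) ?addr_ge0 ?enorm_ge0// oppr_le0 ltW.
  have lp : 0 < l by rewrite lt0r l_neq0.
  exists (map (fun u => l^-1 * u) s); split.
  - rewrite -[X in path _ X](mulr0 l^-1) path_map.
    apply: sub_path s0 => u v uv /=; rewrite ler_wpM2l// invr_ge0//.
  - by rewrite -[X in last X](mulr0 l^-1) last_map sl mulVf.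
  - rewrite -[X in poly_length _ X](mulr0 l^-1) poly_length_map mulr1.
    rewrite (@eq_poly_length _ _ _ g); first by rewrite mul1r in se.
    by move=> u _; rewrite /h /= mulrA mulfV// mul1r.
have hlen t : 0 <= t -> t <= 1 -> curve_length h 0 t = (l * t)%:E.
  exact: (constant_speed_curve_length hl).
have hc : {within `[0%R, 1%R], continuous h}.
  apply: (@subspace_eq_continuous _ _ _ (h \o clamp 1)).
    by move=> t; rewrite inE/= in_itv/= => /andP[t0 t1]; rewrite clamp_id.
  exact/continuous_subspaceT/(constant_speed_clamp_continuous ler01 hl).
have hr : (curve_length h 0 1 < +oo)%E by rewrite hlen// ltry.
have hxy : rectifiable_curve (g 0) (g l) h.
  split=> //; rewrite /h ?mulr0 ?mulr1//.
  by move=> t /andP[t0 t1]; have [] := lt_ t t0 t1; exact: gb.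
apply: (@le_trans _ _ (rho_length rho h)); first by apply: ereal_inf_lbound; exists h.
rewrite /rho_length hlen// mulr1/=.
have [->|l_neq0] := eqVneq l 0; first by rewrite set_itv1 !integral_set1.
rewrite le_eqVlt; apply/orP; left; apply/eqP; apply: eq_integral => s.
rewrite inE/= in_itv/= => /andP[s0 sl].
have lp : 0 < l by rewrite lt0r l_neq0.
have t0 : 0 <= s / l by rewrite divr_ge0.
have t1 : s / l <= 1 by rewrite ler_pdivrMr// mul1r.
have := arclength_paramE hr t0 t1; rewrite hlen//= mulrCA mulfV// mulr1 => ->.
by rewrite /h mulrCA mulfV// mulr1.
Qed.

Lemma rho_dist_xx x : unit_ball x -> rho_dist rho x x = 0%E.
Proof.
move=> xb; apply/eqP; rewrite eq_le rho_dist_ge0 andbT.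
have := @rho_dist_le_integral (cst x) 0 (lexx _).
rewrite set_itv1 integral_set1; apply; last by [].
split=> [s t s0 st t0|e e0].
  by rewrite subrr enorm0 mul1r subr_ge0.
by exists [::]; split => //=; rewrite mulr0 sub0r oppr_le0 ltW.
Qed.

Section Concatenation.
Variables (g h : R -> 'rV[R]_n) (a b : R).
Hypotheses (a0 : 0 <= a) (b0 : 0 <= b) (gh : g a = h b).
Hypotheses (ga : constant_speed g 1 a) (hb : constant_speed h 1 b).

(** The second curve is run backwards: both curves start at the points to be joined and end at the
    common point. *)
Let k s := if s <= a then g s else h (a + b - s).

Let kr s : a <= s -> k s = h (a + b - s).
Proof.
rewrite le_eqVlt /k => /predU1P[<-|sa]; first by rewrite lexx addrAC subrr add0r.
by rewrite leNgt sa.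
Qed.

Lemma concat_rev_constant_speed : constant_speed k 1 (a + b).
Proof.
have [glip gpoly] := ga; have [hlip hpoly] := hb; split.
  move=> s t s0 st tab; rewrite mul1r.
  have hlip' u v : a <= u -> u <= v -> v <= a + b -> enorm (k v - k u) <= v - u.
    move=> au uv vab; rewrite !kr ?(le_trans au)// enorm_distC.
    by rewrite (le_trans (hlip _ _ _ _ _))//; lra.
  have glip' u v : 0 <= u -> u <= v -> v <= a -> enorm (k v - k u) <= v - u.
    move=> u0 uv va; rewrite /k va (le_trans uv va).
    by rewrite (le_trans (glip _ _ _ _ _))// mul1r.
  have [ta|/ltW at_] := leP t a; first exact: glip'.
  have [sa|/ltW as_] := leP s a; last exact: hlip'.
  (* For parameters on both sides of the junction, the estimate passes through the common point
     [k a]. *)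
  rewrite (le_trans (enorm_triangle (k a) _ _))//.
  by have := glip' s a s0 sa (lexx _); have := hlip' a t (lexx _) at_ tab; lra.
move=> e e0; have e2 : 0 < e / 2 by rewrite divr_gt0.
have [s1 [p1 l1 L1]] := gpoly _ e2; have [s2 [p2 l2 L2]] := hpoly _ e2.
(* The reflection [r] maps the partition of [0, b], reversed, to one of [a, a + b]. [belast] drops
   the vertex [b], whose image [a] already ends [s1]. *)
pose r u := a + b - u.
have rb : r b = a by rewrite /r addrK.
have last_rev : last b (rev (belast 0 s2)) = 0.
  rewrite -l2; case: (s2) => //= c s; by rewrite rev_cons last_rcons.
exists (s1 ++ map r (rev (belast 0 s2))); split.
- rewrite cat_path p1 l1 -rb path_map -l2 rev_path/=.
  by apply: sub_path p2 => u v uv; rewrite /= /r lerD2l lerN2.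
- by rewrite last_cat l1 -{1}rb last_map last_rev /r subr0.
- rewrite poly_length_cat l1 -[X in poly_length _ X (map _ _)]rb poly_length_map.
  rewrite -[X in poly_length _ X (rev _)]l2 poly_length_rev.
  rewrite (@eq_poly_length _ _ _ g _ s1); last first.
    by move=> u /(path_le_bounds p1)/andP[_]; rewrite l1 /k => ->.
  rewrite (@eq_poly_length _ _ _ h _ s2); first lra.
  move=> u /(path_le_bounds p2)/andP[u0]; rewrite l2 => ub /=.
  by rewrite kr /r; [congr h; lra|lra].
Qed.

Hypothesis gb : forall s, 0 <= s -> s <= a -> unit_ball (g s).
Hypothesis hb' : forall s, 0 <= s -> s <= b -> unit_ball (h s).

Lemma rho_dist_concat_rev : (rho_dist rho (g 0%R) (h 0%R) <=
  \int[lebesgue_measure]_(s in `[0%R, a]) (rho (g s))%:E +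
  \int[lebesgue_measure]_(s in `[0%R, b]) (rho (h s))%:E)%E.
Proof.
have kb s : 0 <= s -> s <= a + b -> unit_ball (k s).
  move=> s0 sab; have [sa|/ltW sa] := leP s a; first by rewrite /k sa; exact: gb.
  by rewrite kr//; apply: hb'; lra.
have ab0 : 0 <= a + b by rewrite addr_ge0.
have kc := concat_rev_constant_speed.
have := rho_dist_le_integral ab0 kc kb.
rewrite (_ : k 0 = g 0); last by rewrite /k a0.
rewrite (_ : k (a + b) = h 0); last by rewrite kr ?lerDl// subrr.
move=> /le_trans; apply.
have kcont := rho_clamp_continuous ab0 kc kb.
have -> : (\int[lebesgue_measure]_(s in `[0%R, (a + b)%R]) (rho (k s))%:E =
    \int[lebesgue_measure]_(s in `[0%R, (a + b)%R]) (rho (k (clamp (a + b) s)))%:E)%E.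
  apply: eq_integral.
  by move=> s; rewrite inE/= in_itv/= => /andP[s0 s1]; rewrite clamp_id.
have mk (D : set R) : measurable_fun D (rho \o (k \o clamp (a + b)) : R -> R).
  by apply: measurable_funTS; exact: continuous_measurable_fun.
(* The integral is split at the junction [a]; the second piece is then matched with the integral
   along [h] by reflection. *)
rewrite (@itv_bndbnd_setU _ _ _ (BRight a)); [|by rewrite bnd_simp..|]; last first.
  by rewrite bnd_simp lerDl.
rewrite ge0_integral_setU//=; last 2 first.
- by move=> s _; rewrite lee_fin ltW//; apply/rho_gt0/kb; rewrite ?clamp_ge0 ?clamp_le.
- rewrite disj_set2E; apply/eqP/seteqP; split => // s [] /=.
  by rewrite !in_itv/= => /andP[_ sa] /andP[]; rewrite ltNge sa.
rewrite leeD//.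
  rewrite le_eqVlt; apply/orP; left; apply/eqP; apply: eq_integral => s.
  rewrite inE/= in_itv/= => /andP[s0 sa]; rewrite clamp_id//; first by rewrite /k sa.
  by rewrite (le_trans sa)// lerDl.
have hcont := rho_clamp_continuous b0 hb hb'.
have -> : (\int[lebesgue_measure]_(s in `[0%R, b]) (rho (h s))%:E =
    \int[lebesgue_measure]_(s in `[0%R, b]) (rho (h (clamp b s)))%:E)%E.
  apply: eq_integral.
  by move=> s; rewrite inE/= in_itv/= => /andP[s0 s1]; rewrite clamp_id.
have := @integral_reflect _ (rho \o (h \o clamp b)) a (a + b) (a + b).
rewrite subrr addrAC subrr add0r lerDl => /(_ b0 hcont) ->.
rewrite integral_itv_obnd_cbnd//.
rewrite le_eqVlt; apply/orP; left; apply/eqP; apply: eq_integral => s.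
rewrite inE/= in_itv/= => /andP[as_ sab].
rewrite /= !clamp_id ?kr ?subr_ge0 ?(le_trans a0)//.
by rewrite lerBlDl lerD2r.
  by apply/measurable_EFinP; exact: mk.
by apply/measurable_EFinP; exact: mk.
Qed.

End Concatenation.

(** The arclength parametrizations of a curve from [x] to [z] and of one from [y] to [z] are
    concatenated, the second reversed. Having [z] in second place in both terms builds symmetry into
    the inequality. *)
Lemma rho_dist_triangle x y z :
  (rho_dist rho x y <= rho_dist rho x z + rho_dist rho y z)%E.
Proof.
apply: lee_ereal_inf2 => [_ [g /rho_length_ge0 + <-]|_ [g /rho_length_ge0 + <-]|]//.
move=> _ _ [g [gc gb g0 g1 gr] <-] [h [hc hb h0 h1 hr] <-].
have lge0 (f : R -> 'rV[R]_n) : 0 <= fine (curve_length f 0 1).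
  by rewrite fine_ge0// curve_length_ge0.
have ball (f : R -> 'rV[R]_n) : {within `[0%R, 1%R], continuous f} ->
    (curve_length f 0 1 < +oo)%E ->
    (forall t, 0 <= t <= 1 -> unit_ball (f t)) ->
    forall s, 0 <= s -> s <= fine (curve_length f 0 1) ->
    unit_ball (arclength_param f s).
  move=> fc fr fb s s0 s1; have [t [t0 t1 <-]] := length_surj fc fr s0 s1.
  by rewrite arclength_paramE//; apply: fb; rewrite t0.
have a0 (f : R -> 'rV[R]_n) : (curve_length f 0 1 < +oo)%E ->
    arclength_param f 0 = f 0.
  by move=> fr; rewrite -{1}(length0 fr) arclength_paramE.
have := @rho_dist_concat_rev (arclength_param g) (arclength_param h) _ _
  (lge0 g) (lge0 h).
rewrite !arclength_paramE// g1 h1 !a0// g0 h0; apply => //.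
- exact: arclength_param_constant_speed.
- exact: arclength_param_constant_speed.
- exact: ball.
- exact: ball.
Qed.

End RhoDistance.

Local Open Scope ereal_scope.

(** * Completions *)

Lemma ereal_cauchy_cvg {R : realType} (a : nat -> \bar R) :
  (forall i, 0 <= a i) ->
  (forall e : R, (0 < e)%R -> exists N, forall i j, (N <= i)%N -> (N <= j)%N ->
    a i <= a j + e%:E) ->
  cvg (a i @[i --> \oo]).
Proof.
move=> a0 ha; have [N hN] := ha _ ltr01.
(* Distances may be infinite a priori: an infinite value in the tail forces the whole tail to be
   infinite; otherwise the tail is a real Cauchy sequence. *)
have [aN|aN] := eqVneq (a N) +oo.
  apply: (@is_cvg_near_cst _ _ +oo); exists N => // j Nj.
  by have := hN N j (leqnn _) Nj; rewrite aN; case: (a j).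
have afin i : (N <= i)%N -> a i \is a fin_num.
  move=> Ni; rewrite ge0_fin_numE// (le_lt_trans (hN i N Ni (leqnn _)))//.
  by move: aN (a0 N); case: (a N) => [r| |]//; rewrite -EFinD ltry.
suff : cvg ((fine \o a) i @[i --> \oo]).
  move=> /cvg_ex[/= l al]; apply/cvg_ex; exists l%:E; apply/fine_cvgP; split => //.
  by exists N.
apply/cauchy_cvgP/cauchy_exP => e e0.
have e2 : (0 < e / 2)%R by rewrite divr_gt0.
have [M hM] := ha _ e2.
pose K := maxn N M; exists (fine (a K)); exists K => // j /= Kj.
have Nj : (N <= j)%N by rewrite (leq_trans _ Kj)// leq_maxl.
have Mj : (M <= j)%N by rewrite (leq_trans _ Kj)// leq_maxr.
have NK : (N <= K)%N by rewrite leq_maxl.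
have MK : (M <= K)%N by rewrite leq_maxr.
have := hM _ _ MK Mj; have := hM _ _ Mj MK.
rewrite -(fineK (afin _ Nj)) -(fineK (afin _ NK)) -!EFinD !lee_fin /ball/= => h1 h2.
by rewrite ltr_norml; apply/andP; split; lra.
Qed.

Section CompletionDist.
Context {R : realType} {T : pointedType}.
Variables (X : set T) (d : T -> T -> \bar R).
Hypothesis d_ge0 : forall x y, 0 <= d x y.
Hypothesis d_xx : forall x, X x -> d x x = 0.
Hypothesis d_triangle : forall x y z, d x y <= d x z + d y z.

(** Since [d x x = 0] on [X], a Cauchy sequence lies in its own class; the class is therefore
    nonempty and [get] returns one of its members. *)
Lemma get_cauchy_in p : completion X d p -> cauchy_in X d (get p).
Proof.
move=> [u [uX uc] ->]; suff [//] : cauchy_class X d u (get (cauchy_class X d u)).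
apply: (@getPex _ (cauchy_class X d u)); exists u; split => //.
under eq_fun do rewrite d_xx//; exact: cvg_cst.
Qed.

(** By two triangle inequalities, [d (u i) (v i)] exceeds [d (u j) (v j)] by at most
    [d (u i) (u j) + d (v i) (v j)]. *)
Lemma is_cvg_completion_dist p q : completion X d p -> completion X d q ->
  cvg (d ((get p : nat -> T) i) ((get q : nat -> T) i) @[i --> \oo]).
Proof.
move=> /get_cauchy_in[uX uc] /get_cauchy_in[vX vc].
set u := (get p : nat -> T) in uX uc *; set v := (get q : nat -> T) in vX vc *.
apply: ereal_cauchy_cvg => // e e0; have e2 : (0 < e / 2)%R by rewrite divr_gt0.
have [N1 h1] := uc _ e2; have [N2 h2] := vc _ e2.
exists (maxn N1 N2) => i j; rewrite !geq_max => /andP[i1 i2] /andP[j1 j2].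
apply: le_trans (d_triangle _ _ (u j)) _.
apply: le_trans (leeD2l _ (d_triangle _ _ (v j))) _.
rewrite addeA addeC [X in _ + X%:E]splitr EFinD leeD2l// leeD// ltW//.
  exact: h1.
exact: h2.
Qed.

Lemma completion_dist_ge0 p q : completion X d p -> completion X d q ->
  0 <= completion_dist d p q.
Proof.
move=> pX qX; apply: lime_ge; first exact: is_cvg_completion_dist.
by near=> i; exact: d_ge0.
Unshelve. all: by end_near. Qed.

Lemma completion_dist_triangle p q r :
  completion X d p -> completion X d q -> completion X d r ->
  completion_dist d p q <= completion_dist d p r + completion_dist d q r.
Proof.
move=> pX qX rX; have cpr := is_cvg_completion_dist pX rX.
have cqr := is_cvg_completion_dist qX rX.
have def : lim (d ((get p : nat -> T) i) ((get r : nat -> T) i) @[i --> \oo]) +?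
    lim (d ((get q : nat -> T) i) ((get r : nat -> T) i) @[i --> \oo]).
  by apply: ge0_adde_def; rewrite inE; exact: completion_dist_ge0.
rewrite /completion_dist -limeD//.
apply: lee_lim; first exact: is_cvg_completion_dist.
  exact: is_cvgeD.
by near=> i; exact: d_triangle.
Unshelve. all: by end_near. Qed.

End CompletionDist.

Lemma esumZ_le {R : realType} {I : choiceType} (D : set I) (w : I -> \bar R) (k : R) :
  (0 <= k)%R -> (forall i, 0 <= w i) ->
  \esum_(i in D) (k%:E * w i) <= k%:E * \esum_(i in D) w i.
Proof.
move=> k0 w0; apply: ge_ereal_sup => _ [F [finF FD] <-].
rewrite -ge0_mule_fsumr// lee_wpmul2l ?lee_fin//.
by apply: ereal_sup_ubound; exists F.
Qed.

(** Pick in each [S m] an element within [e / 2 ^ (m + 1)] of the infimum. This is the common core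
    of countable subadditivity for Hausdorff contents and packing measures. *)
Lemma ereal_inf_series {R : realType} (S : nat -> set (\bar R)) (S' : set (\bar R)) :
  (forall m h, S m h -> 0 <= h) ->
  (forall h : nat -> \bar R, (forall m, S m (h m)) -> S' (\sum_(m <oo) h m)) ->
  ereal_inf S' <= \sum_(m <oo) ereal_inf (S m).
Proof.
move=> S0 SS'.
have inf0 m : 0 <= ereal_inf (S m) by apply: le_ereal_inf_tmp => h /S0.
have [[m infoo]|fin] := pselect (exists m, ereal_inf (S m) = +oo).
  by rewrite (nneseries_pinfty (k := m))// leey.
apply/lee_addgt0Pr => e e0.
apply: le_trans (epsilon_trick (fun _ => true) inf0 (ltW e0)).
have /choice[h hS] m : exists h, S m h /\ h <= ereal_inf (S m) + (e / (2 ^ m.+1)%:R)%:E.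
  have infm : ereal_inf (S m) \is a fin_num.
    by rewrite ge0_fin_numE// ltey; apply/eqP => infoo; apply: fin; exists m.
  have em : (0 < e / (2 ^ m.+1)%:R)%R by rewrite divr_gt0// ltr0n expn_gt0.
  by have [h Sh /ltW] := lb_ereal_inf_adherent em infm; exists h.
apply: le_trans (_ : \sum_(m <oo) h m <= _).
  by apply: ereal_inf_lbound; apply: SS' => m; case: (hS m).
by apply: lee_nneseries => m; have [/S0] := hS m.
Qed.

Lemma countable_pairs : exists e : nat -> nat * nat, set_bij setT setT e.
Proof. by apply/card_set_bijP; rewrite card_eq_sym card_nat2. Qed.

Lemma esum_pairs {R : realType} (D : nat -> set nat) (w : nat -> nat -> \bar R)
    (e : nat -> nat * nat) : set_bij setT setT e -> (forall m i, 0 <= w m i) ->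
  \esum_(k in [set k | D (e k).1 (e k).2]) w (e k).1 (e k).2 =
  \sum_(m <oo) \esum_(i in D m) w m i.
Proof.
move=> [_ einj esurj] w0; rewrite nneseries_esumT => [|m]; last exact: esum_ge0.
rewrite esum_esum//.
rewrite (@reindex_esum _ _ _ [set k | D (e k).1 (e k).2] _ e)//; split.
- by move=> k Dk.
- by move=> i j _ _; apply: einj; rewrite inE.
- by move=> p [_ Dp]; have [k _ kp] := esurj p I; exists k => //=; rewrite kp.
Qed.

(** * Hausdorff and packing measures *)

Section MetricDimension.
Context {R : realType} {T : Type}.
Variables (X : set T) (d : T -> T -> \bar R).
Implicit Types (A B : set T) (s e : R).

Lemma mdiam_ge0 A : 0 <= mdiam d A.
Proof. by apply: ereal_sup_ubound; left. Qed.

Lemma le_mdiam A x y : A x -> A y -> d x y <= mdiam d A.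
Proof. by move=> Ax Ay; apply: ereal_sup_ubound; right; exists x => //; exists y. Qed.

Lemma mdiam_le A (k : \bar R) : 0 <= k -> (forall x y, A x -> A y -> d x y <= k) ->
  mdiam d A <= k.
Proof. by move=> k0 Ak; apply: ge_ereal_sup => _ [->//|[x Ax [y Ay <-]]]; exact: Ak. Qed.

Lemma hausdorff_content_ge0 s e A : 0 <= hausdorff_content X d s e A.
Proof.
apply: le_ereal_inf_tmp => _ [D [U [_ _ ->]]].
by apply: esum_ge0 => i _; exact: poweR_ge0.
Qed.

Lemma hausdorff_content_bigcup s e (F : nat -> set T) :
  hausdorff_content X d s e (\bigcup_m F m) <=
  \sum_(m <oo) hausdorff_content X d s e (F m).
Proof.
apply: ereal_inf_series => [m _ [D [U [_ _ ->]]]|h].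
  by apply: esum_ge0 => i _; exact: poweR_ge0.
move=> /choice[D] /choice[U hDU]; have [k k_bij] := countable_pairs.
exists [set i | D (k i).1 (k i).2], (fun i => U (k i).1 (k i).2); split.
- move=> x [m _ Fx]; have [/(_ _ Fx)[i Di Ux] _ _] := hDU m.
  by have [_ _ /(_ (m, i) I)[j _ kj]] := k_bij; exists j; rewrite /= kj.
- by move=> i; have [_ /(_ (k i).2) + _] := hDU (k i).1; exact.
- rewrite (@esum_pairs _ D (fun m i => mdiam d (U m i) `^ s))// => [|m i]; last exact: poweR_ge0.
  by apply: eq_eseriesr => m _; have [_ _] := hDU m.
Qed.

Lemma hausdorff_content_cvg s A : hausdorff_content X d s e A @[e --> 0^'+] -->
  ereal_sup [set hausdorff_content X d s e A | e in `]0%R, +oo[].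
Proof.
apply: (@nonincreasing_at_right_cvge _ _ _ +oo%O) => // e e' _ _ ee'.
apply: ereal_inf_le_tmp => _ [D [U [AU UX ->]]]; exists D, U; split => // i Di.
by have [UiX Ue] := UX _ Di; split => //; rewrite (le_trans Ue)// lee_fin.
Qed.

Lemma hausdorff_content_le_measure s e A : (0 < e)%R ->
  hausdorff_content X d s e A <= hausdorff_measure X d s A.
Proof.
move=> e0; rewrite /hausdorff_measure (cvg_lim _ (hausdorff_content_cvg (s := s) (A := A)))//.
by apply: ereal_sup_ubound; exists e => //; rewrite /= in_itv/= e0.
Qed.

(** The contents increase as [e] decreases, so their limit is a supremum; null sets can then be
    treated scale by scale. *)
Lemma hausdorff_measure_eq0P s A : hausdorff_measure X d s A = 0 <->
  forall e, (0 < e)%R -> hausdorff_content X d s e A <= 0.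
Proof.
split=> [A0 e e0|A0]; first by rewrite -A0 hausdorff_content_le_measure.
rewrite /hausdorff_measure (cvg_lim _ (hausdorff_content_cvg (s := s) (A := A)))//.
apply/eqP; rewrite eq_le; apply/andP; split.
  by apply: ge_ereal_sup => _ [e /=] + <-; rewrite in_itv/= andbT; exact: A0.
rewrite (le_trans (hausdorff_content_ge0 s 1 A))//.
by apply: ereal_sup_ubound; exists 1%R => //=; rewrite in_itv/= ltr01.
Qed.

Lemma hausdorff_measure_bigcup_eq0 s (F : nat -> set T) :
  (forall m, hausdorff_measure X d s (F m) = 0) ->
  hausdorff_measure X d s (\bigcup_m F m) = 0.
Proof.
move=> F0; apply/hausdorff_measure_eq0P => e e0.
rewrite (le_trans (hausdorff_content_bigcup _ _ _))// eseries0// => m _ _.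
apply/eqP; rewrite eq_le hausdorff_content_ge0 andbT.
by apply/(hausdorff_measure_eq0P s _).1.
Qed.

(** The empty packing is admissible; [x0] supplies the values of its centre function, which is total
    on [nat]. *)
Lemma packing_content_ge0 (x0 : T) s e A : 0 <= packing_content X d s e A.
Proof.
apply: ereal_sup_ubound; exists set0, (fun=> x0), (fun=> 0%R).
by split => //; rewrite esum_set0.
Qed.

Lemma packing_content_cvg s A : packing_content X d s e A @[e --> 0^'+] -->
  ereal_inf [set packing_content X d s e A | e in `]0%R, +oo[].
Proof.
apply: (@nondecreasing_at_right_cvge _ _ _ +oo%O) => // e e' _ _ ee'.
apply: ge_ereal_sup => _ [D [x [r [xr tx ->]]]]; apply: ereal_sup_ubound.
exists D, x, r; split => // i Di.
by have [Ax /andP[r0 re]] := xr _ Di; rewrite r0 (le_trans re).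
Qed.

Lemma packing_premeasure_le_content s e A : (0 < e)%R ->
  packing_premeasure X d s A <= packing_content X d s e A.
Proof.
move=> e0; rewrite /packing_premeasure (cvg_lim _ (packing_content_cvg (s := s) (A := A)))//.
by apply: ereal_inf_lbound; exists e => //; rewrite /= in_itv/= e0.
Qed.

Lemma le_packing_premeasure s A (k : \bar R) :
  (forall e, (0 < e)%R -> k <= packing_content X d s e A) ->
  k <= packing_premeasure X d s A.
Proof.
move=> kA; rewrite /packing_premeasure (cvg_lim _ (packing_content_cvg (s := s) (A := A)))//.
by apply: le_ereal_inf_tmp => _ [e /=] + <-; rewrite in_itv/= andbT; exact: kA.
Qed.

Lemma packing_premeasure_ge0 (x0 : T) s A : 0 <= packing_premeasure X d s A.
Proof. by apply: le_packing_premeasure => e _; exact: packing_content_ge0. Qed.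

Lemma packing_measure_ge0 (x0 : T) s A : 0 <= packing_measure X d s A.
Proof.
apply: le_ereal_inf_tmp => _ [V _ ->]; apply: nneseries_ge0 => m _ _.
exact: packing_premeasure_ge0.
Qed.

Lemma packing_measure_bigcup_eq0 (x0 : T) s (F : nat -> set T) :
  (forall m, packing_measure X d s (F m) = 0) ->
  packing_measure X d s (\bigcup_m F m) = 0.
Proof.
move=> F0; apply/eqP; rewrite eq_le packing_measure_ge0// andbT.
apply: le_trans (_ : _ <= \sum_(m <oo) packing_measure X d s (F m)) _; last first.
  by rewrite eseries0// => m _ _.
apply: ereal_inf_series => [m _ [V _ ->]|h].
  by apply: nneseries_ge0 => i _ _; exact: packing_premeasure_ge0.
move=> hS; have /choice[V hV] m : exists V : nat -> set T,
    (F m `<=` \bigcup_i V i /\ (forall i, V i `<=` X)) /\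
    h m = \sum_(i <oo) packing_premeasure X d s (V i).
  by have [V ? ?] := hS m; exists V.
have [k k_bij] := countable_pairs.
exists (fun i => V (k i).1 (k i).2).
  split => [x [m _ Fx]|i]; last by have [[_ ]] := hV (k i).1.
  have [[/(_ _ Fx)[i _ Vx] _] _] := hV m.
  by have [_ _ /(_ (m, i) I)[j _ kj]] := k_bij; exists j; rewrite ?kj.
have V0 m i : 0 <= packing_premeasure X d s (V m i) by exact: packing_premeasure_ge0.
rewrite [RHS]nneseries_esumT//.
have := @esum_pairs _ (fun=> setT) (fun m i => packing_premeasure X d s (V m i)) _ k_bij V0.
rewrite (_ : [set j | [set: nat] (k j).2] = setT)//.
move=> ->; apply: eq_eseriesr => m _; have [_ ->] := hV m.
by rewrite nneseries_esumT.
Qed.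

End MetricDimension.

(** * Transfer of null sets between two metrics *)

Section Transfer.
Context {R : realType} {T T' I : Type}.
Variables (X : set T) (d : T -> T -> \bar R) (Y : set T') (d' : T' -> T' -> \bar R).
Variables (phi : I -> T) (psi : I -> T') (W : set I).
Hypothesis psiY : forall i, W i -> Y (psi i).
Variables (k a s : R).
Hypotheses (k0 : (0 < k)%R) (a0 : (0 < a)%R) (s0 : (0 <= s)%R).

Lemma small_radius (e e0 : R) : (0 < e)%R -> (0 < e0)%R ->
  exists r : R, [/\ (0 < r)%R, (r <= e0)%R & (k * r `^ a <= e)%R].
Proof.
move=> e_gt0 e0_gt0; exists (Num.min e0 ((e / k) `^ a^-1)%R).
have h : (0 < (e / k) `^ a^-1)%R by rewrite powR_gt0// divr_gt0.
split; [by rewrite lt_min e0_gt0|by rewrite ge_min lexx|].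
rewrite mulrC -ler_pdivlMr//.
apply: (@le_trans _ _ (((e / k) `^ a^-1) `^ a)%R).
  apply: ge0_ler_powR; rewrite ?nnegrE ?le_min ?(ltW e0_gt0) ?(ltW a0) ?(ltW h)//.
  by rewrite ge_min lexx orbT.
by rewrite -powRrM mulVf ?gt_eqF// powRr1// divr_ge0 ?ltW.
Qed.

Lemma powR_scale (t : R) : (0 <= t)%R ->
  ((k * t `^ a) `^ s = k `^ s * t `^ (s * a))%R.
Proof.
by move=> t0; rewrite powRM ?powR_ge0 ?ltW// [(s * a)%R]mulrC powRrM.
Qed.

(** Covers are pushed from [X] to [Y]: a set of diameter [t] becomes one of diameter at most
    [k t^a], whose [s]-th power is [k^s t^(s a)]. Both spaces are parametrized by the same index set
    [W], so the lemma serves the boundary map in either direction without inverting it. *)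
Lemma hausdorff_null_transfer (e0 : R) : (0 < e0)%R ->
  (forall i j r, W i -> W j -> (0 <= r <= e0)%R -> d (phi i) (phi j) <= r%:E ->
    d' (psi i) (psi j) <= (k * r `^ a)%:E) ->
  hausdorff_measure X d (s * a)%R (phi @` W) = 0 ->
  hausdorff_measure Y d' s (psi @` W) = 0.
Proof.
move=> e0_gt0 holder /hausdorff_measure_eq0P null; apply/hausdorff_measure_eq0P => e e_gt0.
have [r [r0 re0 kre]] := small_radius e_gt0 e0_gt0.
apply/lee_addgt0Pr => eta eta0; rewrite add0e.
have ks0 : (0 < k `^ s)%R by rewrite powR_gt0.
have : hausdorff_content X d (s * a)%R r (phi @` W) < (eta / k `^ s)%:E.
  by rewrite (le_lt_trans (null _ r0))// lte_fin divr_gt0.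
move=> /ereal_inf_lt[_ [D [U [WU UX ->]]] sumU].
apply: (@le_trans _ _ ((k `^ s)%:E * \esum_(i in D) (mdiam d (U i) `^ (s * a)%R))); last first.
  by rewrite -lee_pdivlMl// -EFinM (mulrC _ eta); exact: ltW.
apply: le_trans (esumZ_le _ (ltW ks0) (fun i => poweR_ge0 _ _)).
pose U' i := psi @` (W `&` phi @^-1` U i).
have U'diam i t : D i -> mdiam d (U i) = t%:E -> mdiam d' (U' i) <= (k * t `^ a)%:E.
  move=> Di Ut.
  have t0 : (0 <= t)%R by rewrite -lee_fin -Ut mdiam_ge0.
  apply: mdiam_le; first by rewrite lee_fin mulr_ge0 ?powR_ge0 ?ltW.
  move=> _ _ [i1 [Wi1 Ui1] <-] [i2 [Wi2 Ui2] <-]; apply: holder => //.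
    by rewrite t0 (le_trans _ re0)// -lee_fin -Ut; have [] := UX _ Di.
  by rewrite -Ut le_mdiam.
have Ufin i : D i -> exists2 t : R, mdiam d (U i) = t%:E & (0 <= t <= r)%R.
  move=> Di; have [_] := UX _ Di; have := mdiam_ge0 d (U i).
  case: (mdiam d (U i)) => [t| |]//; rewrite !lee_fin => t0 tr.
  by exists t; rewrite ?t0.
apply: (@le_trans _ _ (\esum_(i in D) (mdiam d' (U' i) `^ s))).
  apply: ereal_inf_lbound; exists D, U'; split=> //.
    move=> _ [i Wi <-]; have [j Dj Uj] := WU _ (imageP phi Wi).
    by exists j => //; exists i.
  move=> i Di; split; first by move=> _ [j [Wj _] <-]; exact: psiY.
  have [t Ut /andP[t0 tr]] := Ufin _ Di.
  rewrite (le_trans (U'diam _ _ Di Ut))// lee_fin (le_trans _ kre)//.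
  by rewrite ler_pM2l// ge0_ler_powR ?nnegrE// ?(ltW a0) ?(ltW r0).
apply: le_esum => i Di; have [t Ut /andP[t0 tr]] := Ufin _ Di.
rewrite Ut poweR_EFin -EFinM -powR_scale// -poweR_EFin.
apply: gt0_ler_poweR; rewrite ?in_itv/= ?leey ?andbT ?mdiam_ge0//; last exact: U'diam.
by rewrite lee_fin mulr_ge0 ?powR_ge0 ?ltW.
Qed.

Lemma packing_esum_le (D : set nat) (t : nat -> R) (h : nat -> T) (e : R) (A : set T) :
  (forall i, D i -> A (h i)) -> (forall i, D i -> (0 < t i)%R) ->
  (forall i, D i -> (k * t i `^ a <= e)%R) ->
  trivIset D (fun i => mball X d (h i) (k * t i `^ a)%R) ->
  (k `^ s)%:E * (\esum_(i in D) (t i `^ (s * a))%:E) <= packing_content X d s e A.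
Proof.
move=> hA t0 te tD.
have ks0 : (0 < k `^ s)%R by rewrite powR_gt0.
rewrite -lee_pdivlMl//.
apply: (@le_trans _ _ (((k `^ s)^-1)%:E * \esum_(i in D) ((k * t i `^ a) `^ s)%:E)).
  apply: le_trans (esumZ_le _ _ _) => [||i]; last 2 first.
  - by rewrite invr_ge0 ltW.
  - by rewrite lee_fin powR_ge0.
  apply: le_esum => i Di; rewrite powR_scale ?(ltW (t0 _ _))// -EFinM lee_fin.
  by rewrite mulrA mulVf ?mul1r// gt_eqF.
rewrite lee_wpmul2l ?lee_fin ?invr_ge0 ?(ltW ks0)//.
apply: ereal_sup_ubound; exists D, h, (fun i => k * t i `^ a)%R; split => // i Di.
by split; [exact: hA|rewrite te// mulr_gt0// powR_gt0// t0].
Qed.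

(** Packings are pulled back from [Y] to [X]: disjoint balls of radii [t i] yield disjoint balls of
    radii [k (t i)^a]. Hence [k^s] times the [s a]-premeasure of a piece in [Y] is at most the
    [s]-premeasure of the corresponding piece in [X]; summing over a countable cover gives the
    result. *)
Lemma packing_null_transfer (i0 : I) (e0 : R) : (0 < e0)%R ->
  (forall i j r r', W i -> W j -> (0 < r <= e0)%R -> (0 < r' <= e0)%R ->
    mball Y d' (psi i) r `&` mball Y d' (psi j) r' = set0 ->
    mball X d (phi i) (k * r `^ a)%R `&` mball X d (phi j) (k * r' `^ a)%R = set0) ->
  packing_measure X d s (phi @` W) = 0 ->
  packing_measure Y d' (s * a)%R (psi @` W) = 0.
Proof.
move=> e0_gt0 sep null; apply/eqP; rewrite eq_le packing_measure_ge0 ?andbT; last first.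
  exact: psi i0.
have ks0 : (0 < k `^ s)%R by rewrite powR_gt0.
have premeasure_le A : (k `^ s)%:E *
    packing_premeasure Y d' (s * a)%R (psi @` (W `&` phi @^-1` A)) <=
    packing_premeasure X d s A.
  apply: le_packing_premeasure => e e_gt0.
  have [r [r0 re0 kre]] := small_radius e_gt0 e0_gt0.
  rewrite -lee_pdivlMl//; apply: le_trans (packing_premeasure_le_content _ _ _ _ r0) _.
  apply: ge_ereal_sup => _ [D [x [t [xt tD ->]]]]; rewrite lee_pdivlMl//.
  have /choice[p hp] i : exists j, D i -> [/\ W j, A (phi j) & psi j = x i].
    have [Di|nDi] := pselect (D i); last by exists i0.
    by have [[j [Wj Aj] jx] _] := xt _ Di; exists j.
  have t0 i : D i -> (0 < t i)%R by move=> /xt[_ /andP[]].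
  have tr i : D i -> (t i <= r)%R by move=> /xt[_ /andP[]].
  apply: (@packing_esum_le _ _ (phi \o p)) => //.
  - by move=> i /hp[].
  - move=> i Di; rewrite (le_trans _ kre)// ler_pM2l//.
    by rewrite ge0_ler_powR ?nnegrE// ?(ltW a0) ?(ltW (t0 _ _)) ?(ltW r0) ?tr.
  - move=> i j Di Dj; apply: contraPP => ij.
    have [Wi _ xi] := hp _ Di; have [Wj _ xj] := hp _ Dj.
    apply/set0P/negP; rewrite negbK; apply/eqP; apply: sep => //.
    + by rewrite t0//= (le_trans (tr _ Di)).
    + by rewrite t0//= (le_trans (tr _ Dj)).
    rewrite xi xj; apply: contrapT => /eqP/set0P xij.
    by apply: ij; exact: (tD _ _ Di Dj).
apply/lee_addgt0Pr => eta eta0; rewrite add0e.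
have : packing_measure X d s (phi @` W) < (k `^ s * eta)%:E.
  by rewrite null lte_fin mulr_gt0.
move=> /ereal_inf_lt[_ [V [WV VX] ->]] sumV.
apply: (@le_trans _ _ (\sum_(m <oo)
    packing_premeasure Y d' (s * a)%R (psi @` (W `&` phi @^-1` V m)))).
  apply: ereal_inf_lbound; exists (fun m => psi @` (W `&` phi @^-1` V m)) => //; split.
    by move=> _ [i Wi <-]; have [m _ Vm] := WV _ (imageP phi Wi); exists m => //; exists i.
  by move=> m _ [i [Wi _] <-]; exact: psiY.
have pre0 m : 0 <= packing_premeasure Y d' (s * a)%R (psi @` (W `&` phi @^-1` V m)).
  by apply: packing_premeasure_ge0; exact: psi i0.
rewrite -(@lee_pmul2l _ (k `^ s)%:E)// -EFinM -nneseriesZl//.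
apply: le_trans (ltW sumV); apply: lee_nneseries => m _//.
by rewrite mule_ge0// lee_fin ltW.
Qed.

End Transfer.

(** * Vitali selection *)

Section VitaliSelection.
Context {R : realType} {I : Type}.
Variables (D : I -> I -> \bar R) (V : set I) (t : I -> R) (e : R).
Hypotheses (D0 : forall i, V i -> D i i = 0) (D_sym : forall i j, D i j = D j i).
Hypotheses (t_gt0 : forall i, V i -> (0 < t i)%R) (t_le : forall i, V i -> (t i <= e)%R).

Let close i j := (D i j < (Num.max (t i) (t j))%:E)%E.

Lemma vitali_selection : exists S : set I, [/\ S `<=` V,
  forall i j, S i -> S j -> i <> j -> (Num.max (t i) (t j))%:E <= D i j &
  forall i, V i -> exists j, [/\ S j, D i j < (2 * t j)%:E & (t i <= 2 * t j)%R]].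
Proof.
(* Zorn over the separated families [S] such that whatever is close to [S] is
   close to an element of [S] of at least half its radius. *)
pose P (S : set I) := [/\ S `<=` V,
  forall i j, S i -> S j -> i <> j -> ~~ close i j &
  forall i, V i -> (exists2 j, S j & close i j) ->
    exists2 j, S j & close i j /\ (t i <= 2 * t j)%R].
have [S [[SV Ssep Scov] Smax]] : exists S, P S /\ forall B, S `<` B -> ~ P B.
  apply: Zorn_bigcup => F FP Ftot; split.
  - by move=> i [S FS Si]; have [+ _ _] := FP _ FS; exact.
  - move=> i j [S FS Si] [S' FS' Sj] ij.
    have [SS'|S'S] := Ftot _ _ FS FS'.
      by have [_ + _] := FP _ FS'; apply => //; exact: SS'.
    by have [_ + _] := FP _ FS; apply => //; exact: S'S.
  - move=> i Vi [j [S FS Sj] ij]; have [_ _ /(_ i Vi)[]] := FP _ FS; first by exists j.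
    by move=> k Sk ik; exists k => //; exists S.
have all_close i : V i -> exists2 j, S j & close i j.
  move=> Vi; apply: contrapT => nclose.
  pose N := [set i | V i /\ ~ exists2 j, S j & close i j].
  have Ni : N i by split.
  have tN : has_sup (t @` N).
    by split; [exists (t i); exists i|exists e => _ [j [Vj _] <-]; exact: t_le].
  have M0 : (0 < sup (t @` N))%R.
    apply: (@lt_le_trans _ _ (t i)); first exact: t_gt0.
    by apply: sup_upper_bound => //; exists i.
  have M2 : (0 < sup (t @` N) / 2)%R by rewrite divr_gt0.
  (* Among the indices not close to [S], [i1] has more than half the supremal radius; adjoining it
     to [S] will contradict maximality. *)
  have [_ [i1 [Vi1 Ni1] <-] i1M] := sup_adherent M2 tN.
  have {}i1M : (sup (t @` N) < 2 * t i1)%R by move: i1M; lra.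
  have close11 : close i1 i1 by rewrite /close D0// lte_fin lt_max t_gt0.
  apply: (Smax (S `|` [set i1])).
    rewrite properEneq; split; last exact: subsetUl.
    apply/eqP => E; have Si1 : S i1 by rewrite E; right.
    by apply: Ni1; exists i1.
  split.
  - by move=> j [/SV//|->].
  - move=> j j' [Sj|->] [Sj'|->] jj'; first exact: Ssep.
    + apply/negP => c; apply: Ni1; exists j => //.
      by move: c; rewrite /close D_sym maxC.
    + by apply/negP => c; apply: Ni1; exists j'.
    + by [].
  (* Either [j] was already close to [S], or it is close to [i1] alone; then [j] belongs to [N], so
     its radius is at most twice that of [i1]. *)
  - move=> j Vj [k0 Sk0 jk0].
    have [[k Sk jk]|nj] := pselect (exists2 k, S k & close j k).
      have [k' Sk' jk'] := Scov _ Vj (ex_intro2 _ _ k Sk jk).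
      by exists k' => //; left.
    exists i1; first by right.
    case: Sk0 jk0 => [Sk0 jk0|-> ji1]; first by case: nj; exists k0.
    split => //; apply/ltW; apply: le_lt_trans i1M.
    by apply: sup_upper_bound => //; exists j.
exists S; split => //.
  by move=> i j Si Sj ij; have := Ssep _ _ Si Sj ij; rewrite /close -leNgt.
move=> i Vi; have [j Sj [ij tij]] := Scov _ Vi (all_close _ Vi).
exists j; split => //; apply: lt_le_trans ij _.
rewrite lee_fin ge_max tij/=; have := t_gt0 (SV _ Sj); lra.
Qed.

End VitaliSelection.

(** * Hausdorff null sets from packing null sets *)

Section PackingToHausdorff.
Context {R : realType} {T T' : Type} {I : pointedType}.
Variables (X : set T) (d : T -> T -> \bar R) (Y : set T') (d' : T' -> T' -> \bar R).
Variables (phi : I -> T) (psi : I -> T') (W : set I).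
Hypothesis psiY : forall i, W i -> Y (psi i).
Hypotheses (d'0 : forall x, d' x x = 0) (d'_sym : forall x y, d' x y = d' y x).
Hypothesis d'_triangle : forall x y z, d' x y <= d' x z + d' z y.
Variables (k a s : R) (good : I -> R -> Prop).
Hypotheses (k0 : (0 < k)%R) (a0 : (0 < a)%R) (s0 : (0 <= s)%R).
Hypothesis good_small : forall i, W i -> forall e : R, (0 < e)%R ->
  exists t, (0 < t <= e)%R /\ good i t.
Hypothesis good_sep : forall i j t t', W i -> W j -> good i t -> good j t' ->
  (0 < t)%R -> (0 < t')%R ->
  t%:E <= d' (psi i) (psi j) -> t'%:E <= d' (psi i) (psi j) ->
  mball X d (phi i) (k * t `^ a)%R `&` mball X d (phi j) (k * t' `^ a)%R = set0.

Let ks0 : (0 < k `^ s)%R. Proof. by rewrite powR_gt0. Qed.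

(** A selected ball of radius [t] is doubled and so has diameter at most [4 t], while the [X]-ball
    of radius [k t^a] contributes [k^s t^(s a)]; [c] is the ratio of the two costs. *)
Let c : R := ((4 `^ (s * a)) / (k `^ s))%R.

Let c0 : (0 < c)%R. Proof. by rewrite divr_gt0// powR_gt0. Qed.

(** If infinitely many radii exceeded some [1 / (m + 1)], the associated disjoint balls would make
    the packing content infinite. So each such level is finite, and [S] is their union. *)
Lemma separated_countable (S : set I) (t : I -> R) (e : R) (A : set T) :
  S `<=` W -> (forall i, S i -> A (phi i)) ->
  (forall i, S i -> [/\ (0 < t i)%R, (k * t i `^ a <= e)%R & good i (t i)]) ->
  (forall i j, S i -> S j -> i <> j ->
    (Num.max (t i) (t j))%:E <= d' (psi i) (psi j)) ->
  packing_content X d s e A < +oo -> countable S.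
Proof.
move=> SW SA St Ssep fin.
pose Sm m := S `&` [set i | (m.+1%:R^-1 <= t i)%R].
have -> : S = \bigcup_m Sm m.
  apply/seteqP; split => [i Si|i [m _ []]//].
  have [ti _ _] := St _ Si.
  have [m mt] : exists m : nat, (m.+1%:R^-1 <= t i)%R.
    have := archi_boundP (ltW (_ : 0 < (t i)^-1)%R); rewrite invr_gt0 => /(_ ti) h.
    exists (Num.bound (t i)^-1); rewrite invf_ple ?posrE//.
    by rewrite (le_trans (ltW h))// ler_nat.
  by exists m.
apply: bigcup_countable => // m _; apply: finite_set_countable.
apply: contrapT => /infiniteP/pcard_leP[g].
have gS i : Sm m (g i) by apply: funS.
have ginj : injective g by move=> i j ij; apply: inj ij; rewrite inE.
have gS' i : S (g i) by have [] := gS i.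
move: fin; apply/negP; rewrite -leNgt leye_eq; apply/eqP/eqyP => M M0.
pose b : R := (k `^ s * (m.+1%:R^-1) `^ (s * a))%R.
have b0 : (0 < b)%R by rewrite mulr_gt0// powR_gt0.
(* Each ball contributes at least [b], so [N] of them already exceed [M]. *)
pose N := Num.bound (M / b).
have MN : (M <= N%:R * b)%R.
  by rewrite -ler_pdivrMr// ltW// archi_boundP// divr_ge0 ?ltW.
apply: (@le_trans _ _ ((N%:R * b)%:E)); first by rewrite lee_fin.
apply: le_trans (@packing_esum_le _ _ X d k a s k0 setT (t \o g) (phi \o g) e A _ _ _ _).
- rewrite mulrCA EFinM lee_wpmul2l ?lee_fin ?(ltW ks0)//.
  rewrite -nneseries_esumT => [|i]; last by rewrite lee_fin powR_ge0.
  apply: le_trans (nneseries_lim_ge N _) => [|i _]; last by rewrite lee_fin powR_ge0.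
  apply: (@le_trans _ _ (\sum_(0 <= i < N) (m.+1%:R^-1 `^ (s * a))%:E)).
    by rewrite sumEFin lee_fin sumr_const_nat subn0 mulr_natl.
  apply: lee_sum => i _; rewrite lee_fin.
  have [_ /= mt] := gS i.
  apply: ge0_ler_powR; rewrite ?nnegrE ?invr_ge0 ?mulr_ge0 ?(ltW a0)//.
  exact: le_trans mt.
- by move=> i _; apply: SA.
- by move=> i _; have [] := St _ (gS' i).
- by move=> i _; have [] := St _ (gS' i).
- move=> i j _ _; apply: contraPP => ij.
  have [ti _ gi] := St _ (gS' i); have [tj _ gj] := St _ (gS' j).
  have := Ssep _ _ (gS' i) (gS' j) (fun E => ij (ginj _ _ E)).
  rewrite EFin_max ge_max => /andP[di dj].
  apply/set0P/negP; rewrite negbK; apply/eqP.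
  by apply: good_sep => //; exact/SW/gS'.
Qed.

(** Choose a good scale at each point and apply the Vitali selection in [Y]. The doubled selected
    balls cover the image of [W], and at good scales the separation of their centres makes the
    corresponding [X]-balls disjoint, that is, a packing. *)
Lemma hausdorff_content_le_packing (e : R) (A : set T) : (0 < e)%R ->
  (forall i, W i -> A (phi i)) ->
  hausdorff_content Y d' (s * a)%R e (psi @` W) <= c%:E * packing_premeasure X d s A.
Proof.
move=> e_gt0 WA; rewrite -lee_pdivrMl//; apply: le_packing_premeasure => eta eta0.
rewrite lee_pdivrMl//.
have [foo|fin] := eqVneq (packing_content X d s eta A) +oo.
  by rewrite foo gt0_muley ?lte_fin// leey.
have {}fin : packing_content X d s eta A < +oo by rewrite ltey.
(* The covering sets will have diameter at most [4 t], which must not exceed [e]. *)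
have e4 : (0 < e / 4)%R by rewrite divr_gt0.
have [r [r0 re kre]] := small_radius k0 a0 eta0 e4.
have /choice[t ht] i : exists t, W i -> (0 < t <= r)%R /\ good i t.
  have [Wi|nWi] := pselect (W i); last by exists 0%R.
  by have [t] := good_small Wi r0; exists t.
have t0 i : W i -> (0 < t i)%R by move=> /ht[/andP[]].
have tr i : W i -> (t i <= r)%R by move=> /ht[/andP[]].
have tg i : W i -> good i (t i) by move=> /ht[].
have kt i : W i -> (k * t i `^ a <= eta)%R.
  move=> Wi; rewrite (le_trans _ kre)// ler_pM2l//.
  by rewrite ge0_ler_powR ?nnegrE// ?(ltW a0) ?(ltW (t0 _ _)) ?(ltW r0) ?tr.
have [S [SW Ssep Scov]] := @vitali_selection _ _ (fun i j => d' (psi i) (psi j)) W t r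
  (fun i _ => d'0 _) (fun i j => d'_sym _ _) t0 tr.
have cS : countable S.
  apply: (separated_countable SW _ _ Ssep fin) => i /SW; first exact: WA.
  by split; [exact: t0|exact: kt|exact: tg].
(* Covers and packings are indexed by subsets of [nat]: [f] numbers the selected indices and [p]
   inverts it on its image. *)
have /countable_injP[f finj] := cS.
have /choice[p hp] n : exists i, (f @` S) n -> S i /\ f i = n.
  have [[i Si fi]|n0] := pselect ((f @` S) n); last by exists point.
  by exists i.
have pS n : (f @` S) n -> S (p n) by move=> /hp[].
pose U n := mball Y d' (psi (p n)) (2 * t (p n))%R.
have diamU n : (f @` S) n -> mdiam d' (U n) <= (4 * t (p n))%:E.
  move=> /pS/SW Wp; apply: mdiam_le; first by rewrite lee_fin mulr_ge0// ltW ?t0.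
  move=> x y [Yx /ltW xp] [Yy /ltW yp]; apply: le_trans (d'_triangle _ _ (psi (p n))) _.
  rewrite d'_sym (_ : 4 * _ = 2 * t (p n) + 2 * t (p n))%R; last by ring.
  by rewrite EFinD leeD.
apply: (@le_trans _ _ (\esum_(n in f @` S) (mdiam d' (U n) `^ (s * a)%R))).
  apply: ereal_inf_lbound; exists (f @` S), U; split => //.
    move=> _ [i Wi <-]; have [j [Sj ij tij]] := Scov _ Wi.
    exists (f j); first by exists j.
    have [Sp fp] := hp _ (imageP f Sj).
    have E : p (f j) = j by apply: finj; rewrite ?inE.
    by rewrite /U E; split; [exact: psiY|rewrite d'_sym].
  move=> n Dn; split; first by move=> y [].
  rewrite (le_trans (diamU _ Dn))// lee_fin.
  have := tr _ (SW _ (pS _ Dn)); move: re; lra.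
apply: (@le_trans _ _ (c%:E * ((k `^ s)%:E *
    (\esum_(n in f @` S) (t (p n) `^ (s * a))%:E)))); last first.
  rewrite lee_wpmul2l ?lee_fin ?(ltW c0)//.
  apply: (@packing_esum_le _ _ X d k a s k0 _ (t \o p) (phi \o p)).
  - by move=> n /pS/SW; exact: WA.
  - by move=> n /pS/SW; exact: t0.
  - by move=> n /pS/SW; exact: kt.
  - move=> n m Dn Dm; apply: contraPP => nm.
    have [Sn fn] := hp _ Dn; have [Sm fm] := hp _ Dm.
    have pnm : p n <> p m by move=> E; apply: nm; rewrite -fn -fm E.
    have := Ssep _ _ Sn Sm pnm; rewrite EFin_max ge_max => /andP[dn dm].
    apply/set0P/negP; rewrite negbK; apply/eqP.
    by apply: good_sep => //; [exact: SW|exact: SW|apply/tg/SW|apply/tg/SW|apply/t0/SW|apply/t0/SW].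
rewrite muleA -EFinM /c divfK ?gt_eqF//.
apply: le_trans (esumZ_le _ _ _); last 2 first.
- exact: powR_ge0.
- by move=> n; rewrite lee_fin powR_ge0.
have tp n : (f @` S) n -> (0 <= t (p n))%R by move=> Dn; exact/ltW/t0/SW/pS.
apply: le_esum => n Dn; rewrite -EFinM -powRM ?tp//.
rewrite -poweR_EFin; apply: gt0_ler_poweR; last exact: diamU.
- by rewrite mulr_ge0// (ltW a0).
- by rewrite in_itv/= mdiam_ge0 leey.
- by rewrite in_itv/= leey lee_fin mulr_ge0// tp.
Qed.

End PackingToHausdorff.

Lemma hausdorff_null_of_packing_null {R : realType} {T T' : Type} {I : pointedType}
    (X : set T) (d : T -> T -> \bar R) (Y : set T') (d' : T' -> T' -> \bar R)
    (phi : I -> T) (psi : I -> T') (W : set I) (k a s : R) (good : I -> R -> Prop) :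
  (forall i, W i -> Y (psi i)) ->
  (forall x, d' x x = 0) -> (forall x y, d' x y = d' y x) ->
  (forall x y z, d' x y <= d' x z + d' z y) ->
  (0 < k)%R -> (0 < a)%R -> (0 <= s)%R ->
  (forall i, W i -> forall e : R, (0 < e)%R -> exists t, (0 < t <= e)%R /\ good i t) ->
  (forall i j t t', W i -> W j -> good i t -> good j t' -> (0 < t)%R -> (0 < t')%R ->
    t%:E <= d' (psi i) (psi j) -> t'%:E <= d' (psi i) (psi j) ->
    mball X d (phi i) (k * t `^ a)%R `&` mball X d (phi j) (k * t' `^ a)%R = set0) ->
  packing_measure X d s (phi @` W) = 0 ->
  hausdorff_measure Y d' (s * a)%R (psi @` W) = 0.
Proof.
move=> psiY d'0 d'_sym d'_tri k0 a0 s0 gsmall gsep null.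
apply/hausdorff_measure_eq0P => e e0; apply/lee_addgt0Pr => eta eta0; rewrite add0e.
pose c : R := (4 `^ (s * a) / k `^ s)%R.
have c0 : (0 < c)%R by rewrite divr_gt0// powR_gt0.
have : packing_measure X d s (phi @` W) < (c^-1 * eta)%:E.
  by rewrite null lte_fin mulr_gt0// invr_gt0.
move=> /ereal_inf_lt[_ [V [WV VX] ->]] sumV.
pose P m := psi @` (W `&` phi @^-1` V m).
apply: (@le_trans _ _ (hausdorff_content Y d' (s * a)%R e (\bigcup_m P m))).
  have WP : psi @` W `<=` \bigcup_m P m.
    by move=> _ [i Wi <-]; have [m _ Vm] := WV _ (imageP phi Wi); exists m => //; exists i.
  apply: ereal_inf_le_tmp => _ [D [U [PU UY ->]]]; exists D, U; split => //.
  exact: subset_trans PU.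
apply: le_trans (hausdorff_content_bigcup _ _ _ _ _) _.
apply: (@le_trans _ _ (\sum_(m <oo) c%:E * packing_premeasure X d s (V m))).
  apply: lee_nneseries => m *; first exact: hausdorff_content_ge0.
  apply: (@hausdorff_content_le_packing _ _ _ _ _ _ _ _ _ _ _ _ d'0 d'_sym d'_tri
    k a s good) => //.
  - by move=> i [Wi _]; exact: psiY.
  - by move=> i [Wi _]; exact: gsmall.
  - by move=> i j t t' [Wi _] [Wj _]; exact: gsep.
  - by move=> i [].
rewrite nneseriesZl => [|m _]; last exact: packing_premeasure_ge0 (phi point) _ _.
by rewrite -lee_pdivlMl// -EFinM; exact: ltW.
Qed.

(** * Comparison of critical exponents *)

Lemma ereal_inf_scale {R : realType} (S1 S2 : set R) (c : R) : (0 < c)%R ->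
  (forall s, S1 s -> (0 <= s)%R) ->
  (forall s c', S1 s -> (c < c')%R -> S2 (s * c')%R) ->
  ereal_inf [set s%:E | s in S2] <= c%:E * ereal_inf [set s%:E | s in S1].
Proof.
move=> c0 S10 S12; rewrite -lee_pdivrMl//; apply: le_ereal_inf_tmp => _ [s Ss <-].
rewrite lee_pdivrMl//; apply/lee_addgt0Pr => e e0.
have s1 : (0 < s + 1)%R by rewrite ltr_wpDl// S10.
(* This factor exceeds [c] yet adds at most [e] after multiplication by [s]; the denominator is
   [s + 1] because [s] may be 0. *)
apply: (@le_trans _ _ (s * (c + e / (s + 1)))%:E).
  apply: ereal_inf_lbound; exists (s * (c + e / (s + 1)))%R => //.
  by apply: S12 => //; rewrite ltrDl divr_gt0.
rewrite -EFinM -EFinD lee_fin mulrDr mulrC lerD2l mulrCA ler_piMr ?(ltW e0)//.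
by rewrite ler_pdivrMr// mul1r lerDl.
Qed.

Lemma hausdorff_measure_eq0S {R : realType} {T : Type} (X : set T) (d : T -> T -> \bar R)
    (s : R) (A B : set T) : A `<=` B ->
  hausdorff_measure X d s B = 0 -> hausdorff_measure X d s A = 0.
Proof.
move=> AB /hausdorff_measure_eq0P B0; apply/hausdorff_measure_eq0P => e e0.
apply: le_trans (B0 e e0); apply: ereal_inf_le_tmp => _ [D [U [BU UX ->]]].
by exists D, U; split => //; exact: subset_trans BU.
Qed.

Lemma packing_measure_eq0S {R : realType} {T : Type} (x0 : T) (X : set T)
    (d : T -> T -> \bar R) (s : R) (A B : set T) : A `<=` B ->
  packing_measure X d s B = 0 -> packing_measure X d s A = 0.
Proof.
move=> AB B0; apply/eqP; rewrite eq_le packing_measure_ge0// andbT -B0.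
apply: ereal_inf_le_tmp => _ [V [BV VX] ->].
by exists V => //; split => //; exact: subset_trans BV.
Qed.

(** * Radial integrals *)

Lemma measurable_scaled_powR {R : realType} (a b : R) (D : set R) :
  measurable_fun D (fun u : R => (a * u `^ b)%:E).
Proof.
by apply/measurable_EFinP; apply: measurable_funTS; exact: measurable_funM.
Qed.

(** The integrand is singular at 0 when [a < 1]. The fundamental theorem of calculus, with primitive
    [u^a], is applied on [1/(n+1), l], followed by monotone convergence. *)
Lemma integral_powR_le {R : realType} (a l : R) : (0 < a)%R -> (0 < l)%R ->
  \int[lebesgue_measure]_(u in `]0%R, l]) (a * u `^ (a - 1))%:E <= (l `^ a)%:E.
Proof.
move=> a0 l0.
pose F n : set R := `[(0 + n.+1%:R^-1)%R, l]%classic.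
have f0 u : 0 <= (a * u `^ (a - 1))%:E by rewrite lee_fin mulr_ge0 ?powR_ge0 ?ltW.
have Fmono : {homo F : n m / (n <= m)%N >-> (n <= m)%O}.
  move=> n m nm; apply/subsetPset => u; rewrite /F /= !in_itv/= => /andP[nu ->].
  by rewrite andbT (le_trans _ nu)// lerD2l lef_pV2 ?posrE// ler_nat.
have mf D := @measurable_scaled_powR R a (a - 1) D.
have h : \int[lebesgue_measure]_(u in F i) (a * u `^ (a - 1))%:E @[i --> \oo] -->
    \int[lebesgue_measure]_(u in \bigcup_i F i) (a * u `^ (a - 1))%:E.
  apply: ge0_nondecreasing_set_cvg_integral; [exact: Fmono|by move=> i; exact: measurable_itv|by move=> i; exact: mf|by []].
rewrite itv_open_bnd_bigcup -(cvg_lim _ h)//.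
apply: lime_le; first by apply/cvg_ex; exists (\int[lebesgue_measure]_(x in \bigcup_i F i) (a * x `^ (a - 1))%:E).
near=> n; rewrite /F add0r; set c : R := (n.+1%:R^-1)%R.
have c0 : (0 < c)%R by rewrite invr_gt0.
have [cl|lc|<-] := ltgtP c l; last 2 first.
- by rewrite set_itv_ge ?integral_set0 ?lee_fin ?powR_ge0// bnd_simp -ltNge.
- by rewrite set_itv1 integral_set1 lee_fin powR_ge0.
have pos u : u \in `[c, l] -> u \in `]0%R, +oo[.
  by rewrite !in_itv/= andbT => /andP[cu _]; exact: lt_le_trans cu.
have cont (b u : R) : u \in `]0%R, +oo[ -> {for u, continuous (fun x : R => (x `^ b)%R)}.
  by move=> u0; apply/differentiable_continuous/derivable1_diffP/derivable_powR.
rewrite (@continuous_FTC2 _ _ (fun x : R => (x `^ a)%R))//.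
- by rewrite -EFinB lee_fin lerBlDr lerDl powR_ge0.
- apply: continuous_in_subspaceT => u; rewrite inE/= => /pos u0.
  by apply: cvgM; [exact: cvg_cst|exact: cont].
- split => /=.
  + move=> u; rewrite in_itv/= => /andP[cu _]; apply: derivable_powR.
    by rewrite in_itv/= andbT (lt_trans c0).
  + by apply: cvg_at_right_filter; apply: cont; apply: pos; rewrite in_itv/= lexx ltW.
  + by apply: cvg_at_left_filter; apply: cont; apply: pos; rewrite in_itv/= lexx ltW.
- move=> u; rewrite in_itv/= => /andP[cu _]; apply: powR_derive1.
  by rewrite in_itv/= andbT (lt_trans c0).
Unshelve. all: by end_near. Qed.

Section RadialIntegral.
Context {R : realType} {n : nat}.
Variable rho : 'rV[R]_n -> R.
Hypothesis rho_cont : {within unit_ball, continuous rho}.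
Hypothesis rho_gt0 : forall x, unit_ball x -> (0 < rho x)%R.
Variable x : 'rV[R]_n.
Hypothesis x1 : (enorm x <= 1)%R.

(** Depths up to 2 occur because the distance of two points of the closed ball can be 2; past the
    centre the segment runs along the opposite radius. *)
Lemma radial_in_ball (t : R) : (0 < t)%R -> (t < 2)%R -> unit_ball ((1 - t) *: x)%R.
Proof.
by move=> t0 t2; apply: enorm_scale_lt1 => //; rewrite ltr_norml; apply/andP; split; lra.
Qed.

Lemma radial_ge0 (t : R) : (0 < t)%R -> (t < 2)%R -> 0 <= (rho ((1 - t) *: x)%R)%:E.
Proof. by move=> t0 t2; rewrite lee_fin ltW//; exact/rho_gt0/radial_in_ball. Qed.

Lemma radial_measurable (l : R) : (l <= 2)%R ->
  measurable_fun `]0%R, l[ (fun t : R => (rho ((1 - t) *: x)%R)%:E).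
Proof.
move=> l2; apply/measurable_EFinP.
apply: open_continuous_measurable_fun; first exact: interval_open.
move=> t; rewrite inE/= in_itv/= => /andP[t0 tl].
apply: (@continuous_comp _ _ _ (fun t : R => (1 - t) *: x)%R rho).
  apply: cvgZr_tmp; apply: cvgB; [exact: cvg_cst|exact: cvg_id].
by apply: (rho_continuous_at rho_cont); apply: radial_in_ball => //; exact: lt_le_trans l2.
Qed.

Lemma radial_integral_ge0 (l : R) : (l <= 2)%R -> 0 <= radial_integral rho x l.
Proof.
move=> l2; apply: integral_ge0 => t; rewrite /= in_itv/= => /andP[t0 tl].
by apply: radial_ge0 => //; exact: lt_le_trans l2.
Qed.

Lemma le_radial_integral (l l' : R) : (l <= l')%R -> (l' <= 2)%R ->
  radial_integral rho x l <= radial_integral rho x l'.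
Proof.
move=> ll' l2; apply: ge0_subset_integral => //; first exact: radial_measurable.
  move=> t; rewrite /= in_itv/= => /andP[t0 tl].
  by apply: radial_ge0 => //; exact: lt_le_trans l2.
by move=> t; rewrite /= !in_itv/= => /andP[-> tl]; exact: lt_le_trans ll'.
Qed.

Lemma radial_integral_upper (a l : R) : (0 < a)%R -> (0 <= l)%R -> (l <= 2)%R ->
  (forall t, (0 < t < l)%R -> (rho ((1 - t) *: x) <= t `^ (a - 1))%R) ->
  radial_integral rho x l <= (a^-1 * l `^ a)%:E.
Proof.
move=> a0; rewrite le_eqVlt => /predU1P[<- _ _|l0 l2 rhole].
  rewrite /radial_integral set_itv_ge ?integral_set0 ?bnd_simp ?ltxx//.
  by rewrite lee_fin mulr_ge0 ?powR_ge0 ?invr_ge0 ?(ltW a0).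
have f0 (u : R) : 0 <= (a * u `^ (a - 1))%:E by rewrite lee_fin mulr_ge0 ?powR_ge0 ?ltW.
have mf D := @measurable_scaled_powR R a (a - 1) D.
apply: (@le_trans _ _ (\int[lebesgue_measure]_(t in `]0%R, l[)
    ((a^-1)%:E * (a * t `^ (a - 1))%:E))).
  apply: ge0_le_integral => //.
  - move=> t; rewrite /= in_itv/= => /andP[t0 tl].
    by apply: radial_ge0 => //; exact: lt_le_trans l2.
  - exact: radial_measurable.
  - by apply: measurable_funeM; exact: mf.
  - move=> t; rewrite /= in_itv/= => tl.
    by rewrite -EFinM mulrA mulVf ?gt_eqF// mul1r lee_fin rhole.
rewrite ge0_integralZl_EFin ?invr_ge0 ?(ltW a0)//.
rewrite EFinM lee_wpmul2l ?lee_fin ?invr_ge0 ?(ltW a0)//.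
  by rewrite integral_itv_bndo_bndc ?integral_powR_le.
exact: mf.
Qed.

(** Harnack's inequality spreads the bound at depth [t] over the depths between [t / 2] and [t], an
    interval of length [t / 2]; this is the origin of the factor [1 / (2 c0)]. *)
Lemma radial_integral_lower (c0 a t : R) : (0 < c0)%R -> (0 < a)%R ->
  (forall x y : 'rV[R]_n, unit_ball x -> (enorm (y - x) < bdist x / 2)%R ->
      (c0^-1 <= rho y / rho x)%R) ->
  (0 < t < 1)%R -> (t `^ (a - 1) <= rho ((1 - t) *: x))%R ->
  ((2 * c0)^-1 * t `^ a)%:E <= radial_integral rho x t.
Proof.
move=> c00 a0 harnack /andP[t0 t1] rhot.
have t2 : (t < 2)%R by lra.
have t22 : (t / 2 < t)%R by lra.
have tb : unit_ball ((1 - t) *: x)%R by exact: radial_in_ball.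
have sub : [set` `](t / 2)%R, t[] `<=` [set` `]0%R, t[].
  by move=> u; rewrite /= !in_itv/= => /andP[u1 ->]; rewrite andbT; lra.
apply: (@le_trans _ _ (\int[lebesgue_measure]_(u in `](t / 2)%R, t[)
    (rho ((1 - u) *: x)%R)%:E)); last first.
  apply: ge0_subset_integral => //; first by apply: radial_measurable; exact: ltW.
  move=> u; rewrite /= in_itv/= => /andP[u0 ut].
  by apply: radial_ge0 => //; exact: lt_trans t2.
apply: (@le_trans _ _ (\int[lebesgue_measure]_(u in `](t / 2)%R, t[)
    (cst (c0^-1 * t `^ (a - 1))%:E u))).
  rewrite integral_cst//= lebesgue_measure_itv/= lte_fin t22.
  rewrite -EFinB -EFinM lee_fin -(mulr_powRB1 (ltW t0) a0) invfM.
  rewrite le_eqVlt; apply/orP; left; apply/eqP; field.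
  by rewrite gt_eqF.
apply: ge0_le_integral => //.
- by move=> u _; rewrite lee_fin mulr_ge0 ?powR_ge0 ?invr_ge0 ?ltW.
- by apply: measurable_funS sub _ => //; apply: radial_measurable; exact: ltW.
- move=> u; rewrite /= in_itv/= => /andP[u1 ut]; rewrite lee_fin.
  apply: (@le_trans _ _ (c0^-1 * rho ((1 - t) *: x))%R).
    by rewrite ler_wpM2l// invr_ge0 ltW.
  rewrite -ler_pdivlMr ?rho_gt0//; apply: harnack => //.
  (* It remains to see that [(t - u) |x| < t / 2 <= (1 - (1 - t) |x|) / 2], using [|x| <= 1]. *)
  rewrite -scalerBl enormZ /bdist enormZ ger0_norm; last by lra.
  rewrite ger0_norm; last by lra.
  have := enorm_ge0 x; move: x1; set e := enorm x => e1 e0.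
  nra.
Qed.

End RadialIntegral.

(** * Power bounds on [rho] from the radial exponents *)

Section RadialExponent.
Context {R : realType} {n : nat}.
Variable rho : 'rV[R]_n -> R.
Hypothesis rho_gt0 : forall x, unit_ball x -> (0 < rho x)%R.
Variable x : 'rV[R]_n.
Hypothesis x1 : (enorm x <= 1)%R.

(** Scales of the form [1 / (m + 1)] are used so that pointwise bounds can be made uniform on
    countably many pieces. *)
Lemma near_left1P (V : set R) : 1^'- V ->
  exists m : nat, forall t : R, (0 < t < m.+1%:R^-1)%R -> V (1 - t)%R.
Proof.
move=> /nbhs_left0P; rewrite near_withinE => /nbhs_ballP[e/= e0 eV].
have ei : (0 <= e^-1)%R by rewrite invr_ge0 ltW.
exists (Num.bound e^-1) => t /andP[t0 tm]; apply: eV => //.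
rewrite /ball/= sub0r normrN ger0_norm ?(ltW t0)//; apply: lt_le_trans tm _.
rewrite invf_ple ?posrE//; apply: le_trans (ltW (archi_boundP ei)) _.
by rewrite ler_nat.
Qed.

(** The logarithm of [t] is negative, so clearing the denominator reverses the inequality. *)
Lemma radial_exponent_lt (b t : R) : (0 < t < 1)%R ->
  (radial_exponent rho x (1 - t) < b%:E) = (t `^ b < rho ((1 - t) *: x))%R.
Proof.
move=> /andP[t0 t1]; rewrite /radial_exponent lte_fin subKr.
have lt : (ln t < 0)%R by rewrite ln_lt0// t0.
have rt : (0 < rho ((1 - t) *: x))%R by apply/rho_gt0/radial_in_ball => //; lra.
by rewrite ltr_ndivrMr// -ln_powR ltr_ln ?posrE// powR_gt0.
Qed.

Lemma radial_exponent_gt (b t : R) : (0 < t < 1)%R ->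
  (b%:E < radial_exponent rho x (1 - t)) = (rho ((1 - t) *: x) < t `^ b)%R.
Proof.
move=> /andP[t0 t1]; rewrite /radial_exponent lte_fin subKr.
have lt : (ln t < 0)%R by rewrite ln_lt0// t0.
have rt : (0 < rho ((1 - t) *: x))%R by apply/rho_gt0/radial_in_ball => //; lra.
by rewrite ltr_ndivlMr// -ln_powR ltr_ln ?posrE// powR_gt0.
Qed.

Lemma k_plus_lt (b : R) : k_plus rho x < b%:E ->
  exists m : nat, forall t : R, (0 < t < m.+1%:R^-1)%R ->
    (t `^ b <= rho ((1 - t) *: x))%R.
Proof.
move=> /ereal_inf_lt[_ [V /near_left1P[m mV] <-] Vb]; exists m => t tm; apply/ltW.
rewrite -radial_exponent_lt.
  by apply: le_lt_trans Vb; apply: ereal_sup_ubound; exists (1 - t)%R => //; exact: mV.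
move/andP: tm => [-> tm]; apply: lt_le_trans tm _.
by rewrite invf_le1// ler1n.
Qed.

Lemma k_minus_gt (b : R) : b%:E < k_minus rho x ->
  exists m : nat, forall t : R, (0 < t < m.+1%:R^-1)%R ->
    (rho ((1 - t) *: x) <= t `^ b)%R.
Proof.
rewrite /k_minus limf_einfE.
move=> /ereal_sup_gt[_ [V /near_left1P[m mV] <-] Vb]; exists m => t tm; apply/ltW.
rewrite -radial_exponent_gt.
  by apply: (lt_le_trans Vb); apply: ereal_inf_lbound; exists (1 - t)%R => //; exact: mV.
move/andP: tm => [-> tm]; apply: lt_le_trans tm _.
by rewrite invf_le1// ler1n.
Qed.

Lemma k_minus_lt (b e : R) : k_minus rho x < b%:E -> (0 < e)%R ->
  exists t : R, [/\ (0 < t <= e)%R, (t < 1)%R & (t `^ b <= rho ((1 - t) *: x))%R].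
Proof.
rewrite /k_minus limf_einfE => kb e0.
(* [V] is a left neighbourhood of 1, so the infimum of the exponent over it is at most the lower
   limit; some radius in [V] therefore has exponent below [b]. *)
pose V : set R := [set r | (0 < 1 - r <= e)%R /\ (1 - r < 1)%R].
have : ereal_inf (radial_exponent rho x @` V) < b%:E.
  apply: le_lt_trans kb; apply: ereal_sup_ubound; exists V => //.
  near=> r; rewrite /V /=; split.
    apply/andP; split; first by rewrite subr_gt0; near: r; exact: nbhs_left_lt.
    by apply/ltW; near: r; exact: nbhs_left_ltBl.
  by rewrite ltrBlDr ltrDl; near: r; exact: nbhs_left_gt.
move=> /ereal_inf_lt[_ [r [/andP[r0 re] r1] <-] rb]; exists (1 - r)%R.
rewrite r0 re; split => //; apply/ltW.
by rewrite -radial_exponent_lt ?r0//= subKr.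
Unshelve. all: by end_near. Qed.

End RadialExponent.

Lemma boundary_map_closed_ball {R : realType} {n : nat} (rho : 'rV[R]_n -> R) p :
  closed_unit_ball (boundary_map rho p).
Proof.
rewrite /boundary_map; case: xgetP => [x _ []//|_].
(* If [get] finds no limit it returns the default [point], which is the zero row. *)
rewrite (_ : point = 0%R); first by rewrite /closed_unit_ball/= enorm0.
by apply/rowP => i; rewrite [RHS]mxE /point/= mxE.
Qed.

(** * Transport of null sets by the boundary map *)

Section DimensionDistortion.
Context {R : realType} {n : nat} {P : pointedType}.
Variable rho : 'rV[R]_n -> R.
Hypothesis rho_cont : {within unit_ball, continuous rho}.
Hypothesis rho_gt0 : forall x, unit_ball x -> (0 < rho x)%R.
Variables (X bd : set P) (drho : P -> P -> \bar R) (f : P -> 'rV[R]_n).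
Hypothesis bdX : bd `<=` X.
Hypothesis drho_triangle : forall p q r, X p -> X q -> X r ->
  drho p q <= drho p r + drho q r.
Hypothesis f1 : forall p, (enorm (f p) <= 1)%R.
Variables c0 c : R.
Hypotheses (c0_gt0 : (0 < c0)%R) (c_gt0 : (0 < c)%R).
Hypothesis harnack : forall x y : 'rV[R]_n, unit_ball x ->
  (enorm (y - x) < bdist x / 2)%R -> (c0^-1 <= rho y / rho x)%R.

Notation "'F' p" := (radial_integral rho (f p)) (at level 10, p at level 9).
Notation dist p q := (enorm (f p - f q)).

Hypothesis comparable : forall p q, bd p -> bd q ->
  (c^-1)%:E * drho p q <= F p (dist p q) + F q (dist p q) /\
  F p (dist p q) + F q (dist p q) <= c%:E * drho p q.

Lemma dist_le2 p q : (dist p q <= 2)%R.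
Proof.
rewrite (le_trans (enormD _ _))// enormN.
by rewrite -[2%R]/(1 + 1)%R lerD//; exact: f1.
Qed.

Lemma euclid_dist_triangle (x y z : 'rV[R]_n) :
  euclid_dist x y <= euclid_dist x z + euclid_dist z y.
Proof. by rewrite /euclid_dist -EFinD lee_fin enorm_triangle. Qed.

Lemma euclid_distC (x y : 'rV[R]_n) : euclid_dist x y = euclid_dist y x.
Proof. by rewrite /euclid_dist enorm_distC. Qed.

Lemma euclid_distxx (x : 'rV[R]_n) : euclid_dist x x = 0.
Proof. by rewrite /euclid_dist subrr enorm0. Qed.

Lemma rho_cdist_le p q (a r : R) : bd p -> bd q -> (0 < a)%R ->
  (dist p q <= r)%R ->
  (forall t, (0 < t < r)%R -> (rho ((1 - t) *: f p) <= t `^ (a - 1))%R) ->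
  (forall t, (0 < t < r)%R -> (rho ((1 - t) *: f q) <= t `^ (a - 1))%R) ->
  drho p q <= (2 * c / a * dist p q `^ a)%:E.
Proof.
move=> pb qb a0 lr hp hq; have [h _] := comparable pb qb.
have hF p' : (forall t, (0 < t < r)%R -> (rho ((1 - t) *: f p') <= t `^ (a - 1))%R) ->
    F p' (dist p q) <= (a^-1 * dist p q `^ a)%:E.
  move=> hp'; apply: radial_integral_upper => //; first exact: enorm_ge0.
    exact: dist_le2.
  by move=> t /andP[t0 tl]; apply: hp'; rewrite t0 (lt_le_trans tl).
move: h => /le_trans /(_ (leeD (hF _ hp) (hF _ hq))).
rewrite -EFinD lee_pdivrMl// -EFinM => /le_trans; apply; rewrite lee_fin.
by rewrite le_eqVlt; apply/orP; left; apply/eqP; field; rewrite gt_eqF.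
Qed.

(** At Euclidean distance 0 both radial integrals in the comparability condition run over an empty
    interval. *)
Lemma rho_cdistxx p : bd p -> drho p p <= 0.
Proof.
move=> pb; have [h _] := comparable pb pb.
move: h; rewrite subrr enorm0 /radial_integral set_itv_ge ?integral_set0 ?adde0; last first.
  by rewrite bnd_simp ltxx.
by rewrite lee_pdivrMl// mule0.
Qed.

Lemma le_rho_cdist p q (t t' u u' : R) : bd p -> bd q ->
  (t <= dist p q)%R -> (t' <= dist p q)%R ->
  u%:E <= F p t -> u'%:E <= F q t' ->
  (u + u')%:E <= c%:E * drho p q.
Proof.
move=> pb qb tl tl' ut ut'; have [_] := comparable pb qb; apply: le_trans.
rewrite EFinD leeD//.
  by apply: le_trans ut _; apply: le_radial_integral => //; exact: dist_le2.
by apply: le_trans ut' _; apply: le_radial_integral => //; exact: dist_le2.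
Qed.

Let kappa : R := ((2 * c0)^-1)%R.
Let kappa_gt0 : (0 < kappa)%R. Proof. by rewrite invr_gt0 mulr_gt0. Qed.

Lemma F_lower p (a t : R) : (0 < a)%R -> (0 < t < 1)%R ->
  (t `^ (a - 1) <= rho ((1 - t) *: f p))%R -> (kappa * t `^ a)%:E <= F p t.
Proof.
move=> a0 t01 h; by apply: radial_integral_lower.
Qed.

(** A common point of the two balls would give [c * drho p q < kappa (t^a + t'^a)], whereas both
    depths are at most the Euclidean distance, so the radial integrals force the opposite
    inequality. *)
Lemma separated_balls p q (a t t' : R) : bd p -> bd q ->
  (kappa * t `^ a)%:E <= F p t -> (kappa * t' `^ a)%:E <= F q t' ->
  t%:E <= euclid_dist (f p) (f q) -> t'%:E <= euclid_dist (f p) (f q) ->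
  mball X drho p (kappa / c * t `^ a)%R `&`
  mball X drho q (kappa / c * t' `^ a)%R = set0.
Proof.
move=> pb qb Fp Fq tl tl'; rewrite !lee_fin in tl tl'.
apply/seteqP; split => // z [[zX pz] [_ qz]].
have := le_rho_cdist pb qb tl tl' Fp Fq.
apply/negP; rewrite -ltNge.
have /le_lt_trans := drho_triangle (bdX pb) (bdX qb) zX.
move=> /(_ _ (lteD pz qz)); rewrite -EFinD => h.
rewrite -lte_pdivlMl// -EFinM; apply: lt_le_trans h _.
rewrite lee_fin le_eqVlt; apply/orP; left; apply/eqP; field.
by rewrite gt_eqF.
Qed.

(** * Sets where [rho] has a uniform radial lower bound *)

Section LowerBoundSets.
Variables (a s : R) (W : set P) (m : nat).
Hypotheses (a0 : (0 < a)%R) (s0 : (0 <= s)%R) (Wb : W `<=` bd).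
Hypothesis Wlower : forall p, W p -> forall t : R, (0 < t < m.+1%:R^-1)%R ->
  (t `^ (a - 1) <= rho ((1 - t) *: f p))%R.

(** Being strictly below [1 / (m + 1)], this scale may itself be used as a depth, and it is less
    than 1. *)
Let t0 : R := (m.+2%:R^-1)%R.
Let t0_gt0 : (0 < t0)%R. Proof. by rewrite invr_gt0. Qed.
Let Wlow p t : W p -> (0 < t <= t0)%R -> (kappa * t `^ a)%:E <= F p t.
Proof.
move=> Wp /andP[tp tt0].
have tm : (t < m.+1%:R^-1)%R by rewrite (le_lt_trans tt0)// ltf_pV2 ?posrE// ltr_nat.
apply: F_lower => //; last by apply: Wlower => //; rewrite tp.
by rewrite tp (lt_le_trans tm)// invf_le1// ler1n.
Qed.

(** The lower bound says [kappa * dist^a <= c * drho] at small scales: [f] is Hölder of exponent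
    [1 / a], and the transfer is applied with [s * a] in place of [s]. *)
Lemma hausdorff_null_lower :
  hausdorff_measure X drho s W = 0 ->
  hausdorff_measure closed_unit_ball euclid_dist (s * a)%R (f @` W) = 0.
Proof.
move=> null.
have ai : (0 < a^-1)%R by rewrite invr_gt0.
have k0 : (0 < (c / kappa) `^ a^-1)%R by rewrite powR_gt0// divr_gt0.
(* Half the value at which [c * e0] would reach [kappa * t0^a]; thus [drho p q <= e0] excludes
   Euclidean distances of [t0] or more. *)
pose e0 : R := (kappa * t0 `^ a / (2 * c))%R.
have kt0 : (0 < kappa * t0 `^ a)%R by rewrite mulr_gt0// powR_gt0.
have e00 : (0 < e0)%R by rewrite divr_gt0// mulr_gt0.
apply: (@hausdorff_null_transfer _ _ _ _ X drho closed_unit_ball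
  euclid_dist idfun f W _ _ a^-1 _ k0 ai _ _ e00).
- by move=> p _; exact: f1.
- by rewrite mulr_ge0// ltW.
- move=> p q r Wp Wq /andP[r0 re0] pqr; rewrite /euclid_dist lee_fin.
  have [->|lp] := eqVneq (dist p q) 0%R; first by rewrite mulr_ge0 ?powR_ge0.
  have {}lp : (0 < dist p q)%R by rewrite lt0r lp enorm_ge0.
  have key t : (0 < t <= t0)%R -> (t <= dist p q)%R -> (kappa * t `^ a <= c * r)%R.
    (* Depth 0 is taken at [q], so that only the integral at [p] is counted. *)
    move=> t01 tl; have := le_rho_cdist (Wb Wp) (Wb Wq) tl (enorm_ge0 _)
      (Wlow Wp t01) (radial_integral_ge0 rho_gt0 (f1 q) (ler0n _ 2)).
    rewrite addr0 -lee_fin EFinM => /le_trans; rewrite EFinM; apply.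
    by rewrite lee_wpmul2l// lee_fin ltW.
  have [lt0|/ltW t0l] := leP (dist p q) t0; last first.
    have := key t0; rewrite t0_gt0 lexx => /(_ isT t0l).
    rewrite leNgt => /negP[]; apply: le_lt_trans (_ : c * e0 < _)%R.
      by rewrite ler_wpM2l// ltW.
    have -> : (c * e0 = kappa * t0 `^ a / 2)%R by rewrite /e0; field; rewrite gt_eqF.
    by lra.
  have := key (dist p q); rewrite lp lt0 lexx => /(_ isT isT).
  rewrite -ler_pdivlMl// => h.
  rewrite -powRM ?divr_ge0 ?(ltW c_gt0) ?(ltW kappa_gt0)//.
  apply: (@le_trans _ _ ((dist p q `^ a) `^ a^-1)%R).
    by rewrite -powRrM mulfV ?gt_eqF// powRr1// ltW.
  apply: ge0_ler_powR; rewrite ?nnegrE ?powR_ge0 ?(ltW ai)//.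
    by rewrite mulr_ge0// divr_ge0// ltW.
  by rewrite (mulrC c) -mulrA.
- by rewrite image_id -mulrA mulfV ?gt_eqF// mulr1.
Qed.

Lemma packing_null_lower :
  packing_measure X drho s W = 0 ->
  packing_measure closed_unit_ball euclid_dist (s * a)%R (f @` W) = 0.
Proof.
move=> null.
have k0 : (0 < kappa / c)%R by rewrite divr_gt0.
apply: (@packing_null_transfer _ _ _ _ X drho closed_unit_ball
  euclid_dist idfun f W _ (kappa / c)%R a s k0 a0 point t0 t0_gt0).
- by move=> p _; exact: f1.
- move=> p q r r' Wp Wq hr hr' disj.
  (* The centre [f q'] lies in its own ball, hence outside the other one; applied both ways, this
     bounds both radii by the distance of the centres. *)
  have sep p' q' r1 r2 : (0 < r2)%R ->
      mball closed_unit_ball euclid_dist (f p') r1 `&`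
      mball closed_unit_ball euclid_dist (f q') r2 = set0 ->
      r1%:E <= euclid_dist (f p') (f q').
    move=> r20 E; rewrite leNgt; apply/negP => lt.
    suff : set0 (f q') by []. rewrite -E; split; split => //.
    - exact: f1.
    - exact: f1.
    - by rewrite euclid_distxx lte_fin.
  have r0 : (0 < r)%R by case/andP: hr.
  have r0' : (0 < r')%R by case/andP: hr'.
  apply: separated_balls; [exact: Wb|exact: Wb|exact: Wlow|exact: Wlow|exact: sep disj|].
  by rewrite euclid_distC; apply: (sep q p r' r) => //; rewrite setIC.
- by rewrite image_id.
Qed.

End LowerBoundSets.

(** * Sets where [rho] has a uniform radial upper bound *)

Section UpperBoundSets.
Variables (a s : R) (W : set P) (m : nat).
Hypotheses (a0 : (0 < a)%R) (s0 : (0 <= s)%R) (Wb : W `<=` bd).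
Hypothesis Wupper : forall p, W p -> forall t : R, (0 < t < m.+1%:R^-1)%R ->
  (rho ((1 - t) *: f p) <= t `^ (a - 1))%R.

Let K : R := (2 * c / a)%R.
Let K0 : (0 < K)%R. Proof. by rewrite divr_gt0// mulr_gt0. Qed.

Let W_upper p q : W p -> W q -> (dist p q <= m.+1%:R^-1)%R ->
  drho p q <= (K * dist p q `^ a)%:E.
Proof.
move=> Wp Wq pq; exact: (rho_cdist_le (Wb Wp) (Wb Wq) a0 pq (Wupper Wp) (Wupper Wq)).
Qed.

Lemma hausdorff_null_upper :
  hausdorff_measure closed_unit_ball euclid_dist s (f @` W) = 0 ->
  hausdorff_measure X drho (s * a^-1)%R W = 0.
Proof.
move=> null; have e00 : (0 < (m.+1%:R^-1 : R))%R by rewrite invr_gt0.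
rewrite -(image_id W).
apply: (@hausdorff_null_transfer _ _ _ _ closed_unit_ball euclid_dist X drho
  f idfun W _ _ a _ K0 a0 _ _ e00).
- by move=> p /Wb/bdX.
- by rewrite mulr_ge0// invr_ge0 ltW.
- move=> p q r Wp Wq /andP[r0 re0]; rewrite lee_fin => pqr.
  apply: (le_trans (W_upper Wp Wq (le_trans pqr re0))).
  by rewrite lee_fin ler_pM2l// ge0_ler_powR ?nnegrE ?enorm_ge0 ?(ltW a0).
- by rewrite -mulrA mulVf ?gt_eqF// mulr1.
Qed.

(** If the two Euclidean balls meet, their centres are so close that the larger of the two
    [drho]-balls contains the centre of the other, and these balls meet too. *)
Lemma packing_null_upper :
  packing_measure closed_unit_ball euclid_dist s (f @` W) = 0 ->
  packing_measure X drho (s * a^-1)%R W = 0.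
Proof.
move=> null; rewrite -(image_id W).
have ai : (0 < a^-1)%R by rewrite invr_gt0.
(* Chosen so that the sum of the two radii is at most [(r / K)^(1/a)], with [r] the larger
   parameter; the bound [K * dist^a] then falls below [r]. *)
pose k : R := ((K^-1) `^ a^-1 / 2)%R.
have k0 : (0 < k)%R by rewrite divr_gt0// powR_gt0// invr_gt0.
have k20 : (0 < 2 * k)%R by rewrite mulr_gt0.
have m0 : (0 < (m.+1%:R^-1 : R))%R by rewrite invr_gt0.
(* Below [e0] the centres are within [1 / (m + 1)], the range of the uniform upper bound. *)
have [e0 [e00 _ ke0]] := small_radius k20 ai m0 ltr01.
have close p q r r' : W p -> W q -> (r <= e0)%R -> (0 < r')%R -> (r' <= r)%R ->
    (dist p q < k * r `^ a^-1 + k * r' `^ a^-1)%R -> drho p q < r%:E.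
  move=> Wp Wq re0 r0' rr' pq; have r0 : (0 < r)%R by exact: lt_le_trans rr'.
  have mono u v : (0 < u)%R -> (u <= v)%R -> (u `^ a^-1 <= v `^ a^-1)%R.
    by move=> u0 uv; rewrite ge0_ler_powR ?nnegrE ?(ltW ai)// ?(ltW u0)// ltW// (lt_le_trans u0).
  have {}pq : (dist p q < 2 * k * r `^ a^-1)%R.
    apply: lt_le_trans pq _; have := mono _ _ r0' rr'.
    by rewrite -(ler_pM2l k0); lra.
  have pqm : (dist p q <= m.+1%:R^-1)%R.
    apply: (le_trans (ltW pq)); apply: le_trans ke0.
    by rewrite ler_pM2l// mono.
  apply: (le_lt_trans (W_upper Wp Wq pqm)); rewrite lte_fin.
  have kE : (2 * k * r `^ a^-1 = (K^-1 * r) `^ a^-1)%R.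
    by rewrite powRM ?invr_ge0 ?(ltW K0) ?(ltW r0)// /k mulrCA mulfV ?mulr1// gt_eqF.
  rewrite -ltr_pdivlMl//; move: pq; rewrite kE => pq.
  have Kr : (0 <= K^-1 * r)%R by rewrite mulr_ge0 ?invr_ge0 ?ltW.
  have -> : (K^-1 * r = ((K^-1 * r) `^ a^-1) `^ a)%R.
    by rewrite -powRrM mulVf ?gt_eqF// powRr1.
  by apply: gt0_ltr_powR; rewrite ?nnegrE ?enorm_ge0 ?powR_ge0.
apply: (@packing_null_transfer _ _ _ _ closed_unit_ball euclid_dist X drho
  f idfun W _ k a^-1 s k0 ai point e0 e00) => //.
  by move=> p /Wb/bdX.
move=> p q r r' Wp Wq /andP[r0 re0] /andP[r0' re0'] disj.
apply/seteqP; split => // z [[_ pz] [_ qz]].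
rewrite !lte_fin in pz qz.
have pq : (dist p q < k * r `^ a^-1 + k * r' `^ a^-1)%R.
  by rewrite (le_lt_trans (enorm_triangle z _ _))// ltrD// enorm_distC.
have self p' u : W p' -> (0 < u)%R -> mball X drho p' u p'.
  move=> Wp' u0; split; first exact/bdX/Wb.
  by rewrite (le_lt_trans (rho_cdistxx (Wb Wp')))// lte_fin.
suff : mball X drho p r `&` mball X drho q r' !=set0 by rewrite disj => -[].
have [rr'|/ltW rr'] := leP r' r.
  exists q; split; last exact: self.
  by split; [exact/bdX/Wb|exact: close pq].
exists p; split; first exact: self.
split; first exact/bdX/Wb.
by apply: (close q p r' r) => //; rewrite enorm_distC [ltRHS]addrC.
Qed.

End UpperBoundSets.

(** The good scales at [p] are the depths [t < 1] where the lower bound holds; [separated_balls]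
    compares two points at unrelated scales, so no uniformity in [p] is required. *)
Lemma hausdorff_null_of_packing_null_lower (a s : R) (W : set P) :
  (0 < a)%R -> (0 <= s)%R -> W `<=` bd ->
  (forall p, W p -> forall e : R, (0 < e)%R -> exists t : R,
    [/\ (0 < t <= e)%R, (t < 1)%R & (t `^ (a - 1) <= rho ((1 - t) *: f p))%R]) ->
  packing_measure X drho s W = 0 ->
  hausdorff_measure closed_unit_ball euclid_dist (s * a)%R (f @` W) = 0.
Proof.
move=> a0 s0 Wb Wlow null.
have k0 : (0 < kappa / c)%R by rewrite divr_gt0.
apply: (@hausdorff_null_of_packing_null _ _ _ _ X drho closed_unit_ball
  euclid_dist idfun f W _ a s
  (fun p t => (t < 1)%R /\ (t `^ (a - 1) <= rho ((1 - t) *: f p))%R)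
  _ euclid_distxx euclid_distC euclid_dist_triangle k0 a0 s0).
- by move=> p _; exact: f1.
- by move=> p Wp e e0; have [t []] := Wlow p Wp e e0; exists t.
- move=> p q t t' Wp Wq [t1 ht] [t1' ht'] t0 t0'.
  apply: separated_balls; [exact: Wb|exact: Wb|apply: F_lower|apply: F_lower] => //.
    by rewrite t0.
  by rewrite t0'.
- by rewrite image_id.
Qed.

End DimensionDistortion.

(** * From null sets to the five dimension inequalities *)

Theorem theorem5p1 (R : realType) (n : nat) (rho : 'rV[R]_n -> R)
  (hrho : is_density rho)
  (hi : exists2 c0 : R, (1 <= c0)%R &
    forall x y : 'rV[R]_n, unit_ball x -> (enorm (y - x) < bdist x / 2)%R ->
      (c0^-1 <= rho y / rho x <= c0)%R)
  (hii : exists2 c : R, (1 <= c)%R &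
    forall p q, rho_boundary rho p -> rho_boundary rho q ->
      let x := boundary_map rho p in
      let y := boundary_map rho q in
      let I := radial_integral rho x (enorm (x - y))
               + radial_integral rho y (enorm (x - y)) in
      (c^-1)%:E * rho_cdist rho p q <= I /\ I <= c%:E * rho_cdist rho p q)
  (beta : R) (hbeta : (-1 < beta)%R)
  (A B C : set (completion_point 'rV[R]_n))
  (hA : A `<=`
    [set p | rho_boundary rho p /\ k_plus rho (boundary_map rho p) <= beta%:E])
  (hB : B `<=`
    [set p | rho_boundary rho p /\ k_minus rho (boundary_map rho p) >= beta%:E])
  (hC : C `<=`
    [set p | rho_boundary rho p /\ k_minus rho (boundary_map rho p) <= beta%:E]) :
  [/\ (1 + beta)%:E * dim_rho rho A >= dim_d (boundary_map rho @` A),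
      (1 + beta)%:E * dim_rho rho B <= dim_d (boundary_map rho @` B),
      (1 + beta)%:E * Dim_rho rho A >= Dim_d (boundary_map rho @` A),
      (1 + beta)%:E * Dim_rho rho B <= Dim_d (boundary_map rho @` B)
    & (1 + beta)%:E * Dim_rho rho C >= dim_d (boundary_map rho @` C)].
Proof.
have rho_cont := density_continuous hrho; have rho_gt0 := density_gt0 hrho.
have [c0 c0_ge1 harnack2] := hi; have [c c_ge1 comparable] := hii.
have c0_gt0 : (0 < c0)%R by rewrite (lt_le_trans _ c0_ge1).
have c_gt0 : (0 < c)%R by rewrite (lt_le_trans _ c_ge1).
have harnack (x y : 'rV[R]_n) : unit_ball x -> (enorm (y - x) < bdist x / 2)%R ->
    (c0^-1 <= rho y / rho x)%R by move=> xb /(harnack2 x y xb)/andP[].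
have f1 p : (enorm (boundary_map rho p) <= 1)%R := boundary_map_closed_ball rho p.
have bdX : rho_boundary rho `<=` rho_completion rho by move=> p [].
have triangle p q r : rho_completion rho p -> rho_completion rho q ->
    rho_completion rho r -> rho_cdist rho p q <= rho_cdist rho p r + rho_cdist rho q r.
  apply: completion_dist_triangle => [x y|x|x y z].
  - exact: rho_dist_ge0.
  - exact: rho_dist_xx.
  - exact: rho_dist_triangle.
have b0 : (0 < 1 + beta)%R by lra.
have bi0 : (0 < (1 + beta)^-1)%R by rewrite invr_gt0.
set f := boundary_map rho in f1 comparable hA hB hC *.
(* For fixed [a], these pieces collect the points whose power bound holds at all depths below
   [1 / (m + 1)]; they exhaust [A] when [a - 1 > beta], and [B] when [a - 1 < beta]. *)
pose Am a m := [set p | A p /\ forall t : R, (0 < t < m.+1%:R^-1)%R ->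
  (t `^ (a - 1) <= rho ((1 - t) *: f p))%R].
pose Bm a m := [set p | B p /\ forall t : R, (0 < t < m.+1%:R^-1)%R ->
  (rho ((1 - t) *: f p) <= t `^ (a - 1))%R].
have AE a : (1 + beta < a)%R -> A = \bigcup_m Am a m.
  move=> ba; apply/seteqP; split => [p Ap|p [m _ []]//].
  have [_ kp] := hA _ Ap.
  have [m hm] : exists m : nat, forall t : R, (0 < t < m.+1%:R^-1)%R ->
      (t `^ (a - 1) <= rho ((1 - t) *: f p))%R.
    by apply: k_plus_lt => //; apply: le_lt_trans kp _; rewrite lte_fin; lra.
  by exists m.
have BE a : (a < 1 + beta)%R -> B = \bigcup_m Bm a m.
  move=> ba; apply/seteqP; split => [p Bp|p [m _ []]//].
  have [_ kp] := hB _ Bp.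
  have [m hm] : exists m : nat, forall t : R, (0 < t < m.+1%:R^-1)%R ->
      (rho ((1 - t) *: f p) <= t `^ (a - 1))%R.
    by apply: k_minus_gt => //; apply: lt_le_trans kp; rewrite lte_fin; lra.
  by exists m.
have Ab a m : Am a m `<=` rho_boundary rho by move=> p [/hA[]].
have Bb a m : Bm a m `<=` rho_boundary rho by move=> p [/hB[]].
(* The bounds for [B] are proved after division by [1 + beta]; the enlarged factor [c'] is then
   [1 / a] with [a < 1 + beta]. *)
have ci (c' : R) : ((1 + beta)^-1 < c')%R -> (0 < c'^-1)%R /\ (c'^-1 < 1 + beta)%R.
  move=> bc; have c'0 : (0 < c')%R by exact: lt_trans bc.
  by rewrite invr_gt0 invf_plt ?posrE.
split.
- apply: ereal_inf_scale => // [s []//|s a [s0 sA] ba].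
  have a0 : (0 < a)%R by exact: lt_trans ba.
  split; first by rewrite mulr_ge0// ltW.
  rewrite (AE _ ba) image_bigcup; apply: hausdorff_measure_bigcup_eq0 => m.
  apply: (hausdorff_null_lower rho_cont rho_gt0 f1 c0_gt0 c_gt0 harnack comparable
    a0 s0 (@Ab a m)) => [p [_ hp]|]; first exact: hp.
  by apply: hausdorff_measure_eq0S sA => p [].
- rewrite -lee_pdivlMl//; apply: ereal_inf_scale => // [s []//|s c' [s0 sB] bc].
  have [a0 ab] := ci _ bc; rewrite -(invrK c').
  split; first by rewrite mulr_ge0// invrK ltW// (lt_trans bi0).
  rewrite (BE _ ab); apply: hausdorff_measure_bigcup_eq0 => m.
  apply: (hausdorff_null_upper rho_cont rho_gt0 bdX f1 c_gt0 comparable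
    a0 s0 (@Bb _ m)) => [p [_ hp]|]; first exact: hp.
  by apply: hausdorff_measure_eq0S sB; apply: image_subset => p [].
- apply: ereal_inf_scale => // [s []//|s a [s0 sA] ba].
  have a0 : (0 < a)%R by exact: lt_trans ba.
  split; first by rewrite mulr_ge0// ltW.
  rewrite (AE _ ba) image_bigcup; apply: (packing_measure_bigcup_eq0 0%R) => m.
  apply: (packing_null_lower rho_cont rho_gt0 bdX triangle f1 c0_gt0 c_gt0 harnack comparable
    a0 (@Ab a m)) => [p [_ hp]|]; first exact: hp.
  by apply: (packing_measure_eq0S point) sA => p [].
- rewrite -lee_pdivlMl//; apply: ereal_inf_scale => // [s []//|s c' [s0 sB] bc].
  have [a0 ab] := ci _ bc; rewrite -(invrK c').
  split; first by rewrite mulr_ge0// invrK ltW// (lt_trans bi0).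
  rewrite (BE _ ab); apply: (packing_measure_bigcup_eq0 point) => m.
  apply: (packing_null_upper rho_cont rho_gt0 bdX f1 c_gt0 comparable
    a0 (@Bb _ m)) => [p [_ hp]|]; first exact: hp.
  by apply: (packing_measure_eq0S 0%R) sB; apply: image_subset => p [].
(* No decomposition of [C] is made: the lower limit provides arbitrarily small good scales at each
   point separately. *)
- apply: ereal_inf_scale => // [s []//|s a [s0 sC] ba].
  have a0 : (0 < a)%R by exact: lt_trans ba.
  split; first by rewrite mulr_ge0// ltW.
  apply: (hausdorff_null_of_packing_null_lower rho_cont rho_gt0 bdX triangle f1
    c0_gt0 c_gt0 harnack comparable a0 s0) sC => [p /hC[]//|p /hC[_ kp] e e0].
  by apply: k_minus_lt => //; apply: le_lt_trans kp _; rewrite lte_fin; lra.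
Qed.
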